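(* Let $\alpha\in(0,1)$ be a constant, and for each $n$ (through which $n\to\infty$, with $\alpha n$ an integer) let $G=G_n$ be an $\alpha n$-regular graph with vertex set $[n]$. Let $m=m(n)$ satisfy $n\log n\ll m\ll n^{5/3}$, let $G(m)$ be obtained from $G$ by adding $m$ random edges, and let the edges of $G(m)$ have independent weights chosen uniformly from $[0,1]$. Then w.h.p. $$mst(G(m))\approx \frac{\zeta(3)}{\alpha}\quad\text{as } n\to\infty .$$ In addition, if $\alpha>1/2$ then the same estimate holds without the use of random edges, i.e. $mst(G)\approx \zeta(3)/\alpha$ as $n\to\infty$, where the edges of $G$ have independent uniform $[0,1]$ weights.
   Context: For a connected graph $H$ whose edges are given independent random weights uniform on $[0,1]$, $mst(H)$ denotes the expected (over the weights) minimum total weight of a spanning tree of $H$. Here $\zeta(k)=\sum_{j\ge 1} j^{-k}$ for integers $k\ge 2$. $G(m)$ is obtained from $G$ by adding a uniformly random set of $m$ edges (pairs of distinct vertices) not in $G$; ''w.h.p.'' (with probability tending to $1$ as $n\to\infty$) in the first assertion refers to the random choice of the $m$ added edges. Notation: $A_n\approx B_n$ means $A_n=(1+o(1))B_n$ as $n\to\infty$; $A_n\gg B_n$ (equivalently $B_n\ll A_n$) means $A_n/B_n\to\infty$. *)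

(* Defs.v *)
From HB Require Import structures.
From mathcomp Require Import all_boot all_order all_algebra.
From mathcomp Require Import all_classical all_reals all_analysis.
Set Implicit Arguments.
Unset Strict Implicit.
Unset Printing Implicit Defensive.
Import Order.TTheory GRing.Theory Num.Theory.
Import numFieldNormedType.Exports.
Local Open Scope classical_set_scope.
Local Open Scope ring_scope.

(* A graph on the vertex set 'I_n is its edge set E : {set {set 'I_n}}; it is
   simple when E \subset complete_graph n. *)
Definition complete_graph (n : nat) : {set {set 'I_n}} :=
  [set e : {set 'I_n} | #|e| == 2%N]%SET.

Definition adj (n : nat) (E : {set {set 'I_n}}) : rel 'I_n :=
  fun u v => [set u; v]%SET \in E.

Definition degree (n : nat) (E : {set {set 'I_n}}) (v : 'I_n) : nat :=
  #|[set e in E | v \in e]%SET|.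

Definition connected_graph (n : nat) (E : {set {set 'I_n}}) : Prop :=
  forall u v : 'I_n, connect (adj E) u v.

Definition acyclic_graph (n : nat) (E : {set {set 'I_n}}) : Prop :=
  forall c : seq 'I_n, (2 < size c)%N -> ~ ucycle (adj E) c.

Definition spanning_tree (n : nat) (E T : {set {set 'I_n}}) : Prop :=
  [/\ T \subset E, connected_graph T & acyclic_graph T].

(* For a connected graph E the infimum ranges over a finite nonempty set and
   is a minimum; for a disconnected E it is the junk value inf set0 = 0. *)
Definition min_tree_weight (R : realType) (n : nat) (E : {set {set 'I_n}})
    (w : {set 'I_n} -> R) : R :=
  inf [set \sum_(e in T) w e | T in [set T | spanning_tree E T]].

Definition mutually_independent (R : realType) (d : measure_display)
    (Omega : measurableType d) (P : probability Omega R) (I : finType)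
    (A : {set I}) (X : I -> {RV P >-> R}) : Prop :=
  forall (J : {set I}) (B : I -> set R),
    J \subset A -> (forall i, measurable (B i)) ->
    P [set x | forall i, i \in J -> B i (X i x)] =
      (\prod_(i in J) P (X i @^-1` B i))%E.

(* One weight for each pair of distinct vertices; a graph E uses only those
   indexed by its own edges. *)
Definition iid_uniform_weights (R : realType) (d : measure_display)
    (Omega : measurableType d) (P : probability Omega R) (n : nat)
    (W : {set 'I_n} -> {RV P >-> R}) : Prop :=
  (forall (e : {set 'I_n}) (B : set R), e \in complete_graph n ->
     measurable B -> distribution P (W e) B = uniform_prob (@ltr01 R) B) /\
  mutually_independent (complete_graph n) W.

Definition mst (R : realType) (d : measure_display)
    (Omega : measurableType d) (P : probability Omega R) (n : nat)
    (W : {set 'I_n} -> {RV P >-> R}) (E : {set {set 'I_n}}) : R :=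
  fine ('E_P[fun x : Omega => min_tree_weight E (fun e => W e x)])%E.

Definition edge_additions (n : nat) (E : {set {set 'I_n}}) (m : nat) :
    {set {set {set 'I_n}}} :=
  [set A : {set {set 'I_n}} | (A \subset complete_graph n :\: E) && (#|A| == m)]%SET.

(* Probability that E :|: A satisfies Q, for A uniform in edge_additions E m. *)
Definition prob_added (R : realType) (n : nat) (E : {set {set 'I_n}}) (m : nat)
    (Q : {set {set 'I_n}} -> Prop) : R :=
  #|[set A in edge_additions E m | `[< Q (E :|: A)%SET >]]%SET|%:R
    / #|edge_additions E m|%:R.

Definition zeta (R : realType) (k : nat) : R :=
  limn (series (fun j : nat => (j.+1%:R ^- k : R))).

Definition much_greater (R : realType) (F : set_system nat) (a b : nat -> R) :
    Prop :=
  a n / b n @[n --> F] --> +oo.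

(* Main.v *)
Require Import Defs.
From HB Require Import structures.
From mathcomp Require Import all_boot all_order all_algebra.
From mathcomp Require Import zify ring lra.
From mathcomp Require Import all_classical all_reals all_analysis.
From mathcomp Require Import measurable_realfun.
Import Order.TTheory GRing.Theory Num.Theory.
Import numFieldNormedType.Exports.

(** Let r = alpha n, and for a connected graph H let H_p be the random graph formed by
the edges of H of weight at most p.  Kruskal's algorithm yields a spanning tree which, for
all p at once, has exactly kappa(H_p) - 1 edges heavier than p, where kappa counts
components, and no spanning tree has fewer.  Writing a weight w as the integral of 1[p < w],
mst(H) is therefore the integral over p in [0, 1] of E kappa(H_p) - 1 ([mst_integral]), and
everything reduces to estimates of E kappa(H_p).

Small components.  Exploring the component of a vertex vertex by vertex in an r-regular
graph compares it from both sides with a Poisson branching process, so the probability that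
the component has k vertices is close to (k r p)^(k-1) / k! * (1-p)^(k r)
([component_size_bounds]).  Its integral over p is a Beta integral, and the components of
size k contribute (n/r) k^(-3) up to a factor 1 + O(k^2/r) ([upper_term], [lower_term]).
The error terms can be summed over all k <= L as long as 4 L^2 <= r; this gives
zeta(3) / alpha.

Upper bound ([mst_upper]).  There are at most n/L components with more than L vertices,
which is negligible on p <= x when x = n^(-5/6) and L is about n^(1/3).  For p >= x a union
bound over the vertex sets with at most r/2 vertices, each of which sends many edges
outside, shows E kappa = O(1), so that the range from x to a small constant delta costs
O(delta).  Beyond delta, E kappa - 1 is at most the expected number of sets of at most n/2
vertices that no present edge leaves; this is [cutsum].

Lower bound ([mst_lower]).  Adding a set A of edges decreases kappa by at most the number of
present edges of A, which is p |A| on average.  Only p <= x matters for the main term, and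
|A| x^2 tends to 0 because |A| = m is much smaller than n^(5/3) = x^(-2).

The two assertions differ only in the reason why [cutsum] is small.  If alpha > 1/2, a set S
with at most n/2 vertices sends at least |S| (alpha - 1/2) n edges outside ([cutsum_dense]).
With m random edges, (1 - q)^|A cap D| has average at most (1 - q m/N)^|D|, where N is the
number of non-edges ([avg_thinning]); since a set with more than r/2 and at most n/2
vertices has of order n^2 pairs across, the average of [cutsum] is at most a negligible term
plus 2^n exp(- c m), and Markov's inequality concludes ([prob_added_ge]). *)

Set Implicit Arguments.
Unset Strict Implicit.
Unset Printing Implicit Defensive.
Local Open Scope ring_scope.

(** * Connected components *)

Section Components.
Import mathcomp.boot.fintype mathcomp.boot.finset.
Local Open Scope set_scope.
Variable n : nat.
Implicit Types (E F A : {set {set 'I_n}}) (u v x y : 'I_n).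

Definition component F v : {set 'I_n} := [set u | connect (adj F) v u]%SET.
Definition components F : {set {set 'I_n}} := [set component F v | v : 'I_n]%SET.
Definition kappa F : nat := #|components F|.

Lemma adj_sym F : symmetric (adj F).
Proof. by move=> u v; rewrite /adj setUC. Qed.

Lemma connect_adj_sym F : connect_sym (adj F).
Proof. exact/sym_connect_sym/adj_sym. Qed.

Lemma mem_component F v u : (u \in component F v) = connect (adj F) v u.
Proof. by rewrite inE. Qed.

Lemma component_refl F v : v \in component F v.
Proof. by rewrite mem_component connect0. Qed.

Lemma component_eqP F u v : reflect (component F u = component F v) (connect (adj F) u v).
Proof.
apply: (iffP idP) => [uv|e]; last by rewrite -mem_component e component_refl.
apply/setP => x; rewrite !mem_component.
exact: (same_connect (@connect_adj_sym F) uv).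
Qed.

Lemma component_partition F : partition (components F) [set: 'I_n]%SET.
Proof.
apply/and3P; split.
- apply/eqP/setP => v; rewrite inE; apply/bigcupP; exists (component F v).
    exact: imset_f.
  exact: component_refl.
- apply/trivIsetP => _ _ /imsetP[u _ ->] /imsetP[v _ ->] neq.
  rewrite -setI_eq0; apply: contraNT neq => /set0Pn[x].
  rewrite inE !mem_component => /andP[ux vx]; apply/eqP/component_eqP.
  by rewrite (connect_trans ux) // connect_adj_sym.
- apply/imsetP => -[v _ /esym/setP/(_ v)].
  by rewrite component_refl inE.
Qed.

Lemma card_component_gt0 F v : (0 < #|component F v|)%N.
Proof. by apply/card_gt0P; exists v; exact: component_refl. Qed.

(** Every component of size s is counted by s terms 1/s; this turns the number of
components into an average over vertices, to which the law of the size of a single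
component applies. *)
Lemma kappa_sum (R : realType) F : (kappa F)%:R = \sum_v (#|component F v|%:R : R)^-1.
Proof.
have /and3P[/eqP cov triv _] := component_partition F.
have -> : \sum_v (#|component F v|%:R : R)^-1 =
    \sum_(v in cover (components F)) (#|component F v|%:R : R)^-1.
  by apply: eq_bigl => v; rewrite cov inE.
rewrite (big_trivIset _ triv) /= /kappa -sumr_const.
apply: eq_bigr => _ /imsetP[v _ ->].
rewrite (eq_bigr (fun=> (#|component F v|%:R : R)^-1)); last first.
  by move=> u; rewrite mem_component => /component_eqP ->.
rewrite sumr_const -[RHS]mulr_natr mulVf // pnatr_eq0 -lt0n.
exact: card_component_gt0.
Qed.

Lemma sub_connect F F' : F \subset F' ->
  subrel (connect (adj F)) (connect (adj F')).
Proof.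
move=> sub; apply: connect_sub => u v uv.
by apply: connect1; exact: (subsetP sub).
Qed.

(** Each component of the larger graph contains a component of the smaller one, so the
components of the smaller graph map onto those of the larger. *)
Lemma kappa_mono F F' : F \subset F' -> (kappa F' <= kappa F)%N.
Proof.
move=> sub; rewrite /kappa.
(* Components contain a vertex, so the default value is never taken. *)
pose f (B : {set 'I_n}) := if [pick x in B] is Some x then component F' x else set0.
suff -> : components F' = [set f B | B in components F]%SET by exact: leq_imset_card.
apply/setP => B; apply/imsetP/imsetP.
  move=> [v _ ->]; exists (component F v); first exact: imset_f.
  rewrite /f; case: pickP => [x|/(_ v)]; last by rewrite component_refl.
  by rewrite mem_component => /(sub_connect sub)/component_eqP.
move=> [_ /imsetP[v _ ->] ->]; exists v => //.
rewrite /f; case: pickP => [x|/(_ v)]; last by rewrite component_refl.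
by rewrite mem_component => /(sub_connect sub)/component_eqP.
Qed.

Lemma adj_add F x y u v : adj ([set x; y]%SET |: F)%SET u v =
  [|| adj F u v, (u == x) && (v == y) | (u == y) && (v == x)].
Proof.
rewrite /adj !inE orbC; congr orb; apply/eqP/orP.
  move=> e.
  have : u \in [set x; y]%SET by rewrite -e !inE eqxx.
  have : v \in [set x; y]%SET by rewrite -e !inE eqxx orbT.
  have : x \in [set u; v]%SET by rewrite e !inE eqxx.
  have : y \in [set u; v]%SET by rewrite e !inE eqxx orbT.
  rewrite !inE; do 4! (case/orP => /eqP ?); subst; rewrite ?eqxx //=;
    first [by left | by right].
by case=> /andP[/eqP -> /eqP ->] //; rewrite setUC.
Qed.

(** A path through the new edge can be cut at its passages through that edge; only one
passage is ever needed. *)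
Lemma connect_add F x y u v : connect (adj ([set x; y]%SET |: F)%SET) u v =
  [|| connect (adj F) u v, connect (adj F) u x && connect (adj F) y v
    | connect (adj F) u y && connect (adj F) x v].
Proof.
set c := connect (adj F).
have csym : symmetric c by move=> ? ?; exact: connect_adj_sym.
have ctr : forall b a d, c a b -> c b d -> c a d.
  by move=> b a d; exact: connect_trans.
apply/idP/idP.
  move=> /connectP[p].
  elim: p u => [|w p ih] u /=; first by move=> _ ->; rewrite /c connect0.
  move=> /andP[uw pw ev]; have {ih pw ev}:= ih _ pw ev.
  move: uw; rewrite adj_add => /or3P[/connect1 uw|/andP[/eqP -> /eqP ->]|/andP[/eqP -> /eqP ->]].
  - by move=> /or3P[h|/andP[h h']|/andP[h h']]; apply/or3P;
    [apply: Or31|apply: Or32|apply: Or33]; rewrite ?h' ?andbT; exact: ctr h.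
  - by move=> /or3P[h|/andP[h h']|/andP[h h']]; apply/or3P;
    [apply: Or32|apply: Or32|apply: Or31]; rewrite ?h /c ?connect0.
  - by move=> /or3P[h|/andP[h h']|/andP[h h']]; apply/or3P;
    [apply: Or33|apply: Or31|apply: Or33]; rewrite ?h /c ?connect0.
have sub : subrel c (connect (adj ([set x; y]%SET |: F)%SET)).
  by apply: sub_connect; apply: subsetUr.
have xy : connect (adj ([set x; y]%SET |: F)%SET) x y.
  by apply: connect1; rewrite adj_add !eqxx orbT.
move=> /or3P[/sub//|/andP[/sub h /sub h']|/andP[/sub h /sub h']].
  exact: connect_trans h (connect_trans xy h').
rewrite connect_adj_sym in xy.
exact: connect_trans h (connect_trans xy h').
Qed.

Lemma component_add_same F x y : connect (adj F) x y ->
  forall v, component ([set x; y]%SET |: F)%SET v = component F v.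
Proof.
move=> xy v; apply/setP => u; rewrite !mem_component connect_add.
case: (boolP (connect (adj F) v u)) => //= /negP vu; apply/negbTE/negP.
have yx : connect (adj F) y x by rewrite connect_adj_sym.
move=> /orP[]/andP[h h']; apply: vu; apply: connect_trans h _.
  exact: connect_trans xy h'.
exact: connect_trans yx h'.
Qed.

Lemma kappa_add_same F x y : connect (adj F) x y ->
  kappa ([set x; y]%SET |: F)%SET = kappa F.
Proof.
move=> xy; rewrite /kappa; congr #|pred_of_set _|.
by apply: eq_imset => v; exact: component_add_same.
Qed.

Lemma component_in F u v : component F v = component F u \/ [disjoint component F v & component F u].
Proof.
have /and3P[_ /trivIsetP tr _] := component_partition F.
case: (eqVneq (component F v) (component F u)) => [->|ne]; [by left|right].
by apply: tr => //; exact: imset_f.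
Qed.

(** The components of the two endpoints are replaced by their union and nothing else
changes. *)
Lemma kappa_add_new F x y : ~~ connect (adj F) x y ->
  (kappa ([set x; y]%SET |: F)%SET).+1 = kappa F.
Proof.
move=> xy; set F' := ([set x; y]%SET |: F)%SET.
set X := component F x; set Y := component F y.
have cF' v : component F' v = if (v \in X) || (v \in Y) then (X :|: Y)%SET else component F v.
  apply/setP => u; rewrite mem_component connect_add /X /Y !mem_component.
  rewrite (connect_adj_sym F v x) (connect_adj_sym F v y).
  case: (boolP (connect (adj F) x v)) => [xv|nxv] /=.
    rewrite !inE; have /component_eqP e := xv.
    rewrite -!mem_component -e !mem_component (negbTE (_ : ~~ connect (adj F) y v)) ?orbF//.
    apply: contra xy => yv; apply: connect_trans xv _.
    by rewrite connect_adj_sym.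
  case: (boolP (connect (adj F) y v)) => [yv|nyv] /=; last by rewrite mem_component orbF.
  rewrite !inE; have /component_eqP e := yv.
  by rewrite -!mem_component -e !mem_component orbC.
have XY : X != Y by apply: contra xy => /eqP/component_eqP.
have XYd : [disjoint X & Y].
  by have [e|//] := component_in F y x; rewrite /X /Y e eqxx in XY.
rewrite /kappa.
have -> : components F' = ((X :|: Y) |: (components F :\ X :\ Y))%SET.
  apply/setP => B; apply/imsetP/setU1P.
    move=> [v _ ->]; rewrite cF'; case: ifP => [_|/norP[vx vy]]; [by left|right].
    rewrite !inE imset_f // andbT; apply/andP; split.
      by apply: contra vy => /eqP <-; exact: component_refl.
    by apply: contra vx => /eqP <-; exact: component_refl.
  move=> [->|]; first by exists x => //; rewrite cF' component_refl.
  rewrite !inE => /and3P[BY BX /imsetP[v _ e]]; exists v => //.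
  rewrite cF'; case: ifP => // /orP[vX|vY].
    case/eqP: BX; rewrite e; apply/esym/component_eqP.
    by rewrite -mem_component.
  case/eqP: BY; rewrite e; apply/esym/component_eqP.
  by rewrite -mem_component.
rewrite cardsU1.
rewrite (_ : (_ \notin _) = true); last first.
  rewrite !inE !negb_and !negbK; apply/orP; right; apply/orP; right.
  apply/imsetP => -[v _ e].
  have : connect (adj F) x y.
    apply/component_eqP; transitivity (component F v).
      by apply/esym/component_eqP; rewrite -mem_component -e inE component_refl.
    by apply/component_eqP; rewrite -mem_component -e inE component_refl orbT.
  by apply/negP.
rewrite (cardsD1 X (components F)) imset_f //= (cardsD1 Y (components F :\ X)).
by rewrite !inE imset_f // eq_sym XY /=.
Qed.

Lemma kappa_add_le F x y : (kappa F <= (kappa ([set x; y]%SET |: F)%SET).+1)%N.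
Proof.
have [h|h] := boolP (connect (adj F) x y).
  by rewrite kappa_add_same.
by rewrite kappa_add_new.
Qed.

Lemma complete_graphP (e : {set 'I_n}) : e \in complete_graph n ->
  exists x y, x != y /\ e = [set x; y]%SET.
Proof. by rewrite inE => /cards2P[x [y [? ?]]]; exists x, y. Qed.

Lemma kappa_union_le F A : A \subset complete_graph n ->
  (kappa F <= kappa (F :|: A)%SET + #|A|)%N.
Proof.
elim: {A}_.+1 {-2}A (ltnSn #|A|) => // k ih A ltA sub.
have [->|/set0Pn[e eA]] := eqVneq A set0; first by rewrite setU0 cards0 addn0.
have [x [y [_ exy]]] := complete_graphP (subsetP sub _ eA).
have cA : #|A| = (#|A :\ e|).+1 by rewrite (cardsD1 e) eA.
have subA' : A :\ e \subset complete_graph n by rewrite (subset_trans _ sub) // subsetDl.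
apply: leq_trans (ih (A :\ e)%SET _ subA') _; first by rewrite -ltnS -cA.
rewrite cA addnS -addSn leq_add2r.
apply: leq_trans (kappa_add_le _ x y) _.
by rewrite -exy (_ : (_ |: _)%SET = (F :|: A)%SET) // setUCA (setD1K eA).
Qed.

Lemma component_set0 v : component finset.set0 v = [set v]%SET.
Proof.
apply/setP => u; rewrite mem_component inE; apply/idP/eqP => [|->]; last exact: connect0.
by case/connectP => -[|w p] //= /andP[]; rewrite /adj inE.
Qed.

Lemma kappa_set0 : kappa finset.set0 = n.
Proof.
rewrite /kappa (_ : components _ = [set [set v]%SET | v : 'I_n]%SET); last first.
  by apply: eq_imset => v; exact: component_set0.
by rewrite card_imset ?card_ord //; exact: set1_inj.
Qed.

Lemma kappa_connected F : connected_graph F -> (0 < n)%N -> kappa F = 1%N.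
Proof.
move=> cF n0; apply/eqP/cards1P; exists (component F (Ordinal n0)).
apply/setP => B; rewrite inE; apply/imsetP/eqP => [[v _ ->]|->].
  by apply/component_eqP; exact: cF.
by exists (Ordinal n0).
Qed.

Lemma connected_kappa F : (kappa F <= 1)%N -> connected_graph F.
Proof.
move=> /card_le1_eqP c1 u v; apply/component_eqP; apply: c1; exact: imset_f.
Qed.

Lemma kappa_gt0 F : (0 < n)%N -> (0 < kappa F)%N.
Proof.
by move=> n0; apply/card_gt0P; exists (component F (Ordinal n0)); exact: imset_f.
Qed.

End Components.

(** * Kruskal's algorithm *)

Section Trees.
Import mathcomp.boot.fintype mathcomp.boot.finset.
Local Open Scope set_scope.
Variable n : nat.
Implicit Types (E F A T H : {set {set 'I_n}}) (u v x y : 'I_n).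

(** An edge of a cycle can be removed without disconnecting the graph, whereas n - 2 edges
cannot connect n vertices. *)
Lemma tree_of_card T : T \subset complete_graph n -> connected_graph T ->
  (#|T| < n)%N -> acyclic_graph T.
Proof.
move=> subT cT ltT [|x [|y [|z c]]] //= _ /andP[].
rewrite /= rcons_path -[path _ _ _]/(path (adj T) z c) => /and3P[xy yz /andP[pc lx]].
rewrite /= !inE !negb_or => /and4P[/and3P[nxy nxz xc] /andP[nyz yc] nzc uc].
set e := [set x; y]%SET; set T' := (T :\ e)%SET.
have eT : (e |: T')%SET = T by rewrite setD1K.
have keep a b : x \notin [set a; b]%SET -> adj T a b -> adj T' a b.
  rewrite /adj => h ab; rewrite in_setD1 ab andbT; apply: contra h => /eqP ->.
  by rewrite !inE eqxx.
have keepp p a : a != x -> x \notin p -> path (adj T) a p -> path (adj T') a p.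
  elim: p a => //= b p ih a ax; rewrite inE negb_or => /andP[xb xp] /andP[ab pp].
  apply/andP; split; last by apply: ih => //; rewrite eq_sym.
  by apply: keep => //; rewrite !inE negb_or eq_sym ax.
(* The rest of the cycle joins y to x without the edge e. *)
have conn : connect (adj T') x y.
  rewrite connect_adj_sym; apply/connectP; exists (rcons (z :: c) x); last by rewrite last_rcons.
  rewrite rcons_path; apply/andP; split.
    apply: keepp; rewrite ?inE ?negb_or ?nxz ?xc //=; first by rewrite eq_sym.
    by rewrite yz.
  have yl : y != last y (z :: c).
    have : last y (z :: c) \in z :: c := mem_last z c.
    by apply: contraTneq => <-; rewrite inE negb_or nyz.
  rewrite /adj !inE; move: lx; rewrite /adj => /= ->; rewrite andbT.
  apply/eqP => /setP/(_ y); rewrite !inE eqxx orbT /=.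
  by rewrite (negbTE yl) /= eq_sym (negbTE nxy).
have n0 : (0 < n)%N by exact: leq_ltn_trans ltT.
have k1 : kappa T' = 1%N.
  by rewrite -(kappa_connected cT n0) -eT kappa_add_same.
have := @kappa_union_le _ finset.set0 T' (subset_trans (subsetDl _ _) subT).
rewrite kappa_set0 set0U k1 add1n => le1.
have : (#|T|  = #|T'|.+1)%N by rewrite (cardsD1 e) -[_ \in T]/(adj T x y) xy.
by move=> cTT; rewrite cTT ltnNge le1 in ltT.
Qed.

Lemma eq_component_connect F F' : (forall v, component F v = component F' v) ->
  connect (adj F) =2 connect (adj F').
Proof. by move=> e u v; rewrite -!mem_component e. Qed.

Lemma eq_component_kappa F F' : (forall v, component F v = component F' v) -> kappa F = kappa F'.
Proof.
by move=> e; rewrite /kappa; congr #|pred_of_set _|; apply: eq_imset => v; exact: e.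
Qed.

(** The greedy forest built from the edges in increasing order.  The last clause is stable
under the induction because, for a threshold p, the edges of weight at most p form an
initial segment of the list, and each edge kept afterwards merges two components. *)
Lemma kruskal (R : realType) (w : {set 'I_n} -> R) (s : seq {set 'I_n}) :
  [set e in s] \subset complete_graph n ->
  sorted (fun e f => w e <= w f) s ->
  exists T, [/\ T \subset [set e in s], forall v, component T v = component [set e in s] v,
    (#|T| + kappa [set e in s] = n)%N &
    forall p, (#|[set e in T | (p < w e)%R]| + kappa [set e in s] =
               kappa [set e in s | (w e <= p)%R])%N].
Proof.
elim/last_ind: s => [_ _|s e ih sub srt].
  exists set0; split; first by rewrite sub0set.
  - by move=> v; congr component; apply/setP => e; rewrite !inE.
  - rewrite cards0 (_ : [set e in [::]] = set0) ?kappa_set0 ?add0n //.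
  - move=> p; rewrite (_ : [set e in set0 | _] = set0) ?cards0 ?add0n.
      by congr kappa; apply/setP => e; rewrite !inE.
    by apply/setP => e; rewrite !inE.
have es : [set f in rcons s e] = e |: [set f in s].
  by apply/setP => f; rewrite !inE mem_rcons inE.
have subs : [set f in s] \subset complete_graph n.
  by apply: subset_trans sub; rewrite es subsetUr.
have wtr : transitive (fun e f => w e <= w f).
  by move=> ? ? ?; exact: le_trans.
have srts : sorted (fun e f => w e <= w f) s.
  by apply: subseq_sorted srt => //; exact: subseq_rcons.
have wmax f : f \in s -> w f <= w e.
  have : sorted (fun e f : {set 'I_n} => w f <= w e) (rev (rcons s e)) by rewrite rev_sorted.
  rewrite rev_rcons /= path_sortedE; last by move=> ? ? ? h h'; exact: le_trans h' h.
  by move=> /andP[/allP h _] fs; apply: h; rewrite mem_rev.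
have [T [subT cT nT pT]] := ih subs srts.
have /complete_graphP[x [y [nxy exy]]] : e \in complete_graph n.
  by apply: (subsetP sub); rewrite inE mem_rcons mem_head.
have filt_lt p : p < w e -> [set f in rcons s e | w f <= p] = [set f in s | w f <= p].
  move=> pe; apply/setP => f; rewrite !inE mem_rcons inE.
  by case: eqP => [->|//]; rewrite leNgt pe !andbF.
have filt_ge p : w e <= p -> [set f in rcons s e | w f <= p] = [set f in rcons s e].
  move=> pe; apply/setP => f; rewrite !inE mem_rcons inE.
  case: eqP => [->//|_] /=; case: (boolP (f \in s)) => //= fs.
  by rewrite (le_trans (wmax _ fs)).
have filt0 T' p : T' \subset [set f in rcons s e] -> w e <= p ->
    [set f in T' | p < w f] = set0.
  move=> sT pe; apply/setP => f; rewrite !inE; apply/negbTE/negP => /andP[/(subsetP sT)].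
  rewrite inE mem_rcons inE => /orP[/eqP ->|/wmax h]; first by rewrite ltNge pe.
  by rewrite ltNge (le_trans h).
have [xy|xy] := boolP (connect (adj [set f in s]) x y).
  have cs v : component [set f in rcons s e] v = component [set f in s] v.
    by rewrite es exy component_add_same.
  exists T; split.
  - by rewrite es (subset_trans subT) // subsetUr.
  - by move=> v; rewrite cs cT.
  - by rewrite (eq_component_kappa cs).
  - move=> p; have [pe|pe] := ltP p (w e).
      by rewrite filt_lt // -pT (eq_component_kappa cs).
    rewrite filt_ge // filt0 ?cards0 //.
    by rewrite es (subset_trans subT) // subsetUr.
have eT : e \notin T.
  apply: contra xy => eT; apply: connect1; rewrite /adj -exy.
  exact: (subsetP subT).
have ks : (kappa [set f in rcons s e]).+1 = kappa [set f in s].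
  by rewrite es exy kappa_add_new.
have subT' : e |: T \subset [set f in rcons s e] by rewrite es setUS.
exists (e |: T); split => //.
- move=> v; apply/setP => u; rewrite es exy !mem_component !connect_add.
  by rewrite !(eq_component_connect cT).
- by rewrite cardsU1 eT add1n addSnnS ks nT.
- move=> p; have [pe|pe] := ltP p (w e).
    rewrite filt_lt // -pT -ks addnS.
    rewrite (_ : [set f in e |: T | _] = e |: [set f in T | p < w f]).
      by rewrite cardsU1 inE (negbTE eT).
    apply/setP => f; rewrite !inE; case: eqP => [->|//].
    by rewrite pe.
  by rewrite filt_ge // filt0 ?cards0.
Qed.

Lemma optimal_tree (R : realType) (w : {set 'I_n} -> R) H :
  (0 < n)%N -> H \subset complete_graph n -> connected_graph H ->
  exists2 T, spanning_tree H T &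
    forall p, (#|[set e in T | (p < w e)%R]%SET|.+1 = kappa [set e in H | (w e <= p)%R]%SET)%N.
Proof.
move=> n0 sub cH.
pose s := sort (fun e f : {set 'I_n} => w e <= w f) (enum H).
have sH : [set e in s] = H by apply/setP => e; rewrite inE mem_sort mem_enum.
have [||T [subT cT nT pT]] := @kruskal R w s; first by rewrite sH.
  by apply: sort_sorted => ? ?; exact: le_total.
rewrite sH in subT cT nT; have k1 := kappa_connected cH n0.
have conT : connected_graph T.
  by move=> u v; rewrite (eq_component_connect cT); exact: cH.
exists T.
  split=> //; apply: tree_of_card => //; first exact: subset_trans subT sub.
  by rewrite -[X in (_ < X)%N]nT k1 addn1.
move=> p; have := pT p; rewrite sH k1 addn1 => ->.
by congr kappa; apply/setP => e; rewrite !inE mem_sort mem_enum.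
Qed.

(** The edges of a spanning tree that are heavier than p connect all components of the
graph of edges of weight at most p. *)
Lemma connected_above (R : realType) (w : {set 'I_n} -> R) H T p :
  (0 < n)%N -> H \subset complete_graph n -> T \subset H -> connected_graph T ->
  (kappa [set e in H | (w e <= p)%R]%SET <= #|[set e in T | (p < w e)%R]%SET|.+1)%N.
Proof.
move=> n0 sub TH cT; rewrite -add1n.
have subT : [set e in T | (p < w e)%R] \subset complete_graph n.
  apply: subset_trans (subset_trans TH sub).
  by apply/subsetP => e; rewrite inE => /andP[].
apply: leq_trans (kappa_union_le _ subT) _; rewrite leq_add2r.
rewrite -(kappa_connected cT n0); apply: kappa_mono.
apply/subsetP => e eT; rewrite !inE eT (subsetP TH _ eT) /=.
by case: leP.
Qed.

End Trees.

(** * Random subsets of a finite set *)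

Section RandomSubset.
Import mathcomp.boot.fintype mathcomp.boot.finset.
Local Open Scope set_scope.
Variables (R : realType) (I : finType).
Implicit Types (A B D E F : {set I}) (p : R) (f g : {set I} -> R).

(** The mean of f over the random subset of E that contains each element independently
with probability p. *)
Definition Ex E p f : R :=
  \sum_(F : {set I} | F \subset E) p ^+ #|F| * (1 - p) ^+ #|E :\: F| * f F.

Lemma sum_subsets_split A B f : [disjoint A & B] ->
  \sum_(F : {set I} | F \subset A :|: B) f F =
  \sum_(F1 : {set I} | F1 \subset A) \sum_(F2 : {set I} | F2 \subset B) f (F1 :|: F2).
Proof.
move=> dAB; rewrite pair_big /=.
rewrite (reindex_onto (fun x : {set I} * {set I} => x.1 :|: x.2)
  (fun F => (F :&: A, F :&: B))) /=; last first.
  by move=> F /setIidPl FAB; rewrite -setIUr.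
apply: eq_bigl => -[F1 F2] /=; apply/andP/andP.
  by move=> [_ /eqP[<- <-]]; rewrite !subsetIr.
move=> [s1 s2]; split; first exact: setUSS.
apply/eqP; congr pair; rewrite setIUl.
  rewrite (setIidPl s1) (_ : F2 :&: A = set0) ?setU0 //.
  by apply/eqP; rewrite setI_eq0 disjoint_sym (disjointWr s2).
rewrite (setIidPl s2) (_ : F1 :&: B = set0) ?set0U //.
by apply/eqP; rewrite setI_eq0 (disjointWl s1).
Qed.

Lemma sum_subsets_card E (f : nat -> R) :
  \sum_(F : {set I} | F \subset E) f #|F| = \sum_(s < #|E|.+1) 'C(#|E|, s)%:R * f s.
Proof.
rewrite (partition_big (fun F => inord #|F| : 'I_#|E|.+1) predT) //=.
apply: eq_bigr => s _.
have cF F : F \subset E -> (inord #|F| == s :> 'I_#|E|.+1) = (#|F| == s).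
  by move=> FE; rewrite -val_eqE /= inordK // ltnS subset_leq_card.
rewrite (eq_bigr (fun=> f s)); last by move=> F /andP[FE]; rewrite cF // => /eqP ->.
rewrite sumr_const -[LHS]mulr_natl; congr (_ %:R * _).
rewrite -cards_draws cardsE; apply: eq_card => F; rewrite !unfold_in.
by case: (boolP (F \subset E)) => //= FE; rewrite cF.
Qed.

Lemma sum_subsets_pow E (a b : R) :
  \sum_(F : {set I} | F \subset E) a ^+ #|F| * b ^+ #|E :\: F| = (a + b) ^+ #|E|.
Proof.
rewrite (eq_bigr (fun F => a ^+ #|F| * b ^+ (#|E| - #|F|))); last first.
  by move=> F FE; rewrite cardsD (setIidPr FE).
rewrite (sum_subsets_card E (fun s => a ^+ s * b ^+ (#|E| - s))) addrC exprDn.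
by apply: eq_bigr => s _; rewrite mulr_natl mulrC.
Qed.

Lemma Ex_const E p (c : R) : Ex E p (fun=> c) = c.
Proof. by rewrite /Ex -mulr_suml sum_subsets_pow addrC subrK expr1n mul1r. Qed.

Lemma ExD E p f g : Ex E p (fun F => f F + g F) = Ex E p f + Ex E p g.
Proof. by rewrite /Ex -big_split; apply: eq_bigr => F _; rewrite mulrDr. Qed.

Lemma ExZ E p (c : R) f : Ex E p (fun F => c * f F) = c * Ex E p f.
Proof. by rewrite /Ex mulr_sumr; apply: eq_bigr => F _; rewrite mulrCA. Qed.

Lemma ExB E p f g : Ex E p (fun F => f F - g F) = Ex E p f - Ex E p g.
Proof.
rewrite -[- Ex E p g]mulN1r -ExZ -ExD; apply: eq_bigr => F _.
by rewrite mulN1r.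
Qed.

Lemma Ex_sum E p (J : finType) (P : pred J) (f : J -> {set I} -> R) :
  Ex E p (fun F => \sum_(j | P j) f j F) = \sum_(j | P j) Ex E p (f j).
Proof.
by rewrite /Ex exchange_big /=; apply: eq_bigr => F _; rewrite mulr_sumr.
Qed.

Lemma eq_Ex E p f g : (forall F, F \subset E -> f F = g F) -> Ex E p f = Ex E p g.
Proof. by move=> e; apply: eq_bigr => F /e ->. Qed.

Lemma Ex_le E p f g : 0 <= p <= 1 -> (forall F, F \subset E -> f F <= g F) ->
  Ex E p f <= Ex E p g.
Proof.
move=> /andP[p0 p1] e; apply: ler_sum => F /e fg; apply: ler_wpM2l => //.
by rewrite mulr_ge0 ?exprn_ge0 // subr_ge0.
Qed.

(** The restrictions of the random subset to disjoint sets are independent. *)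
Lemma Ex_split A B p f : [disjoint A & B] ->
  Ex (A :|: B) p f = Ex A p (fun F1 => Ex B p (fun F2 => f (F1 :|: F2))).
Proof.
move=> dAB; rewrite /Ex sum_subsets_split //.
apply: eq_bigr => F1 s1; rewrite mulr_sumr; apply: eq_bigr => F2 s2.
have d12 : [disjoint F1 & F2] by rewrite (disjointWl s1) // (disjointWr s2).
rewrite cardsU (_ : F1 :&: F2 = set0); last by apply/eqP; rewrite setI_eq0.
have -> : (A :|: B) :\: (F1 :|: F2) = (A :\: F1) :|: (B :\: F2).
  apply/setP => x; rewrite !inE.
  have := disjointFr dAB; have := subsetP s1 x; have := subsetP s2 x.
  move=> /implyP; rewrite implybE => h2 /implyP; rewrite implybE => h1 /(_ x).
  case: (x \in F1) h1 => /=; case: (x \in F2) h2 => /=;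
  case: (x \in A) => /=; case: (x \in B) => //= _ _ h; by have := h isT.
rewrite cardsU (_ : (A :\: F1) :&: (B :\: F2) = set0); last first.
  apply/eqP; rewrite setI_eq0; apply: (disjointWl (subsetDl _ _)).
  exact: (disjointWr (subsetDl _ _)).
by rewrite cards0 !subn0 !exprD; ring.
Qed.

(** The elements on which f does not depend can be integrated out. *)
Lemma Ex_setD D E p f : (forall F, f F = f (F :\: D)) ->
  Ex E p f = Ex (E :\: D) p f.
Proof.
move=> fD; have dis : [disjoint E :\: D & E :&: D].
  rewrite -setI_eq0; apply/eqP/setP => x; rewrite !inE.
  by case: (x \in D); rewrite ?andbF.
rewrite -{1}(setID E D) setUC Ex_split //; apply: eq_Ex => F1 _.
rewrite -[RHS](Ex_const (E :&: D) p (f F1)); apply: eq_Ex => F2 /subsetIP[_ F2D].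
by rewrite fD [in RHS]fD setDUl (_ : F2 :\: D = set0) ?setU0 //; apply/eqP; rewrite setD_eq0.
Qed.

Lemma Ex_avoid D E p : D \subset E ->
  Ex E p (fun F => (F :&: D == set0)%:R) = (1 - p) ^+ #|D|.
Proof.
move=> DE; have -> : E = D :|: (E :\: D) by rewrite setDE setUIr setUCr setIT (setUidPr DE).
have dis : [disjoint D & E :\: D].
  by rewrite -setI_eq0 setIDA setIC -setIDA setDv setI0.
rewrite Ex_split //.
transitivity (Ex D p (fun F1 => (F1 == set0)%:R)).
  apply: eq_Ex => F1 F1D; rewrite -[RHS](Ex_const (E :\: D) p); apply: eq_Ex => F2 F2E.
  congr (nat_of_bool _)%:R; rewrite setIUl (setIidPl F1D).
  rewrite (_ : F2 :&: D = set0) ?setU0 //; apply/eqP; rewrite setI_eq0 disjoint_sym.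
  exact: disjointWr dis.
rewrite /Ex (bigD1 set0) ?sub0set //= big1 ?addr0.
  by rewrite cards0 expr0 mul1r setD0 eqxx mulr1.
by move=> F1 /andP[_ /negbTE ->]; rewrite mulr0.
Qed.

Lemma Ex_card E p : Ex E p (fun F => #|F|%:R) = p * #|E|%:R.
Proof.
have -> : Ex E p (fun F => #|F|%:R) =
    Ex E p (fun F => \sum_(x in E) (1 - (F :&: [set x] == set0)%:R)).
  apply: eq_Ex => F FE; rewrite -sum1_card natr_sum big_mkcond [RHS]big_mkcond /=.
  apply: eq_bigr => x _; case: ifP => xF.
    rewrite (subsetP FE) // (_ : _ == _ = false) ?subr0 //.
    by apply/negbTE/set0Pn; exists x; rewrite !inE xF eqxx.
  rewrite (_ : _ == _ = true) ?subrr ?if_same //.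
  apply/eqP/setP => y; rewrite !inE andbC; case: eqP => [->|//].
  by rewrite xF.
rewrite Ex_sum (eq_bigr (fun=> p)); last first.
  move=> x xE; rewrite ExB Ex_const Ex_avoid ?sub1set // cards1 expr1.
  by rewrite opprB addrC subrK.
by rewrite sumr_const mulr_natr.
Qed.

End RandomSubset.

(** * Exploration of a component *)

Section Exploration.
Import mathcomp.boot.fintype mathcomp.boot.finset.
Local Open Scope set_scope.
Variable n : nat.
Implicit Types (E F G : {set {set 'I_n}}) (Q D : {set 'I_n}) (u v x y : 'I_n).

Definition nbrs F v D : {set 'I_n} := [set u in D | adj F v u].

(** One step removes a vertex v from the active set Q and activates its neighbours within
the set D of untouched vertices.  The test is whether the process dies after exactly k
steps; unlike the component itself, it inspects disjoint sets of edges at different steps.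
*)
Fixpoint explored F (k : nat) Q D : bool :=
  if k is k'.+1 then
    if [pick v in Q] is Some v then
      explored F k' (Q :\ v :|: nbrs F v D) (D :\: nbrs F v D)
    else false
  else Q == set0.

Definition step_into F D : rel 'I_n := fun a b => adj F a b && (b \in D).
(** The vertices accessible from Q by moves that end in D; this is what the exploration
with active set Q and untouched set D discovers. *)
Definition reach F Q D : {set 'I_n} := [set u | [exists q in Q, connect (step_into F D) q u]].

Lemma reach_sub F Q D : Q \subset reach F Q D.
Proof.
by apply/subsetP => q qQ; rewrite inE; apply/existsP; exists q; rewrite qQ connect0.
Qed.

Lemma reach_closed F Q D a b : a \in reach F Q D -> adj F a b -> b \in D ->
  b \in reach F Q D.
Proof.
rewrite !inE => /existsP[q /andP[qQ qa]] ab bD; apply/existsP; exists q.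
by rewrite qQ (connect_trans qa) // connect1 // /step_into ab.
Qed.

Lemma reach_min F Q D (X : {set 'I_n}) : Q \subset X ->
  (forall a b, a \in X -> adj F a b -> b \in D -> b \in X) ->
  reach F Q D \subset X.
Proof.
move=> QX clX; apply/subsetP => u; rewrite inE => /existsP[q /andP[/(subsetP QX) qX]].
move=> /connectP[p]; elim: p q qX => [|b p ih] q qX /=; first by move=> _ ->.
by move=> /andP[/andP[qb bD] pp]; apply: ih => //; exact: clX qb bD.
Qed.

(** Both inclusions follow from the minimality of reach among the sets closed under moves
into D: removing v loses nothing since its untouched neighbours have become active. *)
Lemma reach_step F Q D v : v \in Q -> [disjoint Q & D] ->
  reach F Q D = v |: reach F (Q :\ v :|: nbrs F v D) (D :\: nbrs F v D).
Proof.
move=> vQ dQD; set N := nbrs F v D; set Q' := _ :|: N; set D' := D :\: N.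
have vR : v \in reach F Q D by exact: (subsetP (reach_sub _ _ _)).
have NR : N \subset reach F Q D.
  by apply/subsetP => u; rewrite inE => /andP[uD vu]; exact: reach_closed vR vu uD.
apply/eqP; rewrite eqEsubset; apply/andP; split.
  apply: reach_min.
    apply/subsetP => q qQ; rewrite inE in_set1; case: eqVneq => //= qv.
    by apply: (subsetP (reach_sub _ _ _)); rewrite !inE qv qQ.
  move=> a b; rewrite !in_setU1 => aX ab bD; apply/orP; right.
  have [bN|bN] := boolP (b \in N).
    by apply: (subsetP (reach_sub _ _ _)); rewrite in_setU bN orbT.
  case/orP: aX => [/eqP av|aX].
    by case/negP: bN; rewrite inE bD -av.
  by apply: reach_closed aX ab _; rewrite inE bN.
rewrite subUset sub1set vR /=; apply: reach_min.
  rewrite subUset NR andbT; apply: subset_trans (reach_sub F Q D).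
  exact: subsetDl.
by move=> a b aX ab; rewrite inE => /andP[_]; exact: reach_closed ab.
Qed.

Lemma reach_in F Q D : reach F Q D \subset Q :|: D.
Proof.
apply: reach_min; first exact: subsetUl.
by move=> a b _ _ bD; rewrite inE bD orbT.
Qed.

Lemma reach0 F D : reach F set0 D = set0.
Proof. by apply/eqP; rewrite -subset0; apply: reach_min => // a b; rewrite inE. Qed.

Lemma exploredP F k Q D : [disjoint Q & D] -> explored F k Q D = (#|reach F Q D| == k).
Proof.
elim: k Q D => [|k ih] Q D dQD /=.
  rewrite cards_eq0; apply/eqP/eqP => [->|h]; first exact: reach0.
  by apply/eqP; rewrite -subset0 -h reach_sub.
case: pickP => [v vQ|Q0]; last first.
  suff -> : Q = set0 by rewrite reach0 cards0.
  by apply/setP => x; rewrite Q0 inE.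
have vD : v \notin D by rewrite (disjointFr dQD).
rewrite (reach_step _ vQ dQD) cardsU1 ih.
  rewrite (_ : v \notin _) ?add1n ?eqSS //.
  apply: contra (_ : v \notin (Q :\ v :|: nbrs F v D) :|: (D :\: nbrs F v D)).
    exact/subsetP/reach_in.
  by rewrite !inE eqxx (negbTE vD) andbF.
rewrite -setI_eq0; apply/eqP/setP => x; rewrite !inE.
have := disjointFr dQD; move=> /(_ x).
by case: (x \in Q) => [->//|_]; rewrite ?andbF //= ; case: (x \in D); case: (adj F v x).
Qed.

Lemma reach_component F v : reach F [set v] (~: [set v]) = component F v.
Proof.
apply/eqP; rewrite eqEsubset; apply/andP; split.
  apply: reach_min; first by rewrite sub1set component_refl.
  by move=> a b; rewrite !mem_component => va ab _; exact: connect_trans va (connect1 ab).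
apply/subsetP => u; rewrite mem_component => /connectP[p].
have : v \in reach F [set v] (~: [set v]).
  by apply: (subsetP (reach_sub _ _ _)); rewrite inE.
move: {1 4 5}v => w; elim: p w => [|b p ih] w wR /=; first by move=> _ ->.
move=> /andP[wb pp] e; apply: (ih b) => //.
have [->|bv] := eqVneq b v; first by apply: (subsetP (reach_sub _ _ _)); rewrite inE.
by apply: reach_closed wR wb _; rewrite !inE.
Qed.

Lemma explored_component F v k :
  explored F k [set v] (~: [set v]) = (#|component F v| == k).
Proof.
rewrite exploredP ?reach_component //.
by rewrite -setI_eq0 setICr eqxx.
Qed.

(** The rest of the exploration never looks at edges outside Q and D, which makes it
independent of the edges already inspected. *)
Lemma explored_local F F' k Q D :
  (forall a b, a \in Q :|: D -> b \in D -> adj F a b = adj F' a b) ->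
  explored F k Q D = explored F' k Q D.
Proof.
elim: k Q D => [//|k ih] Q D loc /=.
case: pickP => [v vQ|//].
have -> : nbrs F v D = nbrs F' v D.
  apply/setP => u; rewrite !inE; case: (boolP (u \in D)) => //= uD.
  by apply: loc; rewrite // inE vQ.
apply: ih => a b; rewrite !inE => aX /andP[_ bD]; apply: loc => //.
rewrite inE; move: aX.
by case: (a \in Q); case: (a \in D); rewrite ?andbF.
Qed.

Variable R : realType.

(** The edges joining v to untouched vertices are independent of those that decide the
rest of the exploration, so one can condition on the set N of newly activated vertices. *)
Lemma Ex_explored G p k Q D v : [pick v in Q] = Some v -> v \notin D ->
  Ex G p (fun F => (explored F k.+1 Q D)%:R) =
  \sum_(N : {set 'I_n} | N \subset nbrs G v D)
     p ^+ #|N| * (1 - p) ^+ #|nbrs G v D :\: N| *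
     Ex G p (fun F => (explored F k (Q :\ v :|: N) (D :\: N))%:R : R).
Proof.
move=> pQ vD.
pose g u : {set 'I_n} := [set v; u].
have ginj : injective g.
  move=> u w /setP e; have := e u; have := e w; rewrite !in_set2 !eqxx !orbT.
  move=> /orP[/eqP wv|/eqP //] /esym/orP[/eqP ->|/eqP //].
  by rewrite wv.
set M := nbrs G v D; pose Gv := g @: M.
have GvG : Gv \subset G.
  by apply/subsetP => _ /imsetP[u /[!inE] /andP[_ vu] ->].
have dG : [disjoint Gv & G :\: Gv].
  by rewrite -setI_eq0 setIDA setIC -setIDA setDv setI0.
have eG : G = Gv :|: (G :\: Gv) by rewrite setDE setUIr setUCr setIT (setUidPr GvG).
rewrite {1}eG Ex_split // {1}/Ex.
rewrite (reindex_onto (fun N : {set 'I_n} => g @: N) (fun F1 => g @^-1: F1)) /=; last first.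
  move=> F1 F1G; apply/setP => e; apply/imsetP/idP => [[u]|eF].
    by rewrite inE => ? ->.
  have /imsetP[u _ eu] := subsetP F1G _ eF.
  by exists u => //; rewrite inE -eu.
have gpre (N : {set 'I_n}) : g @^-1: (g @: N) = N.
  by apply/setP => u; rewrite inE mem_imset.
have imS (A B : {set 'I_n}) : (g @: A \subset g @: B) = (A \subset B).
  apply/idP/idP; last exact: imsetS.
  by move/(preimsetS g); rewrite !gpre.
apply: eq_big => [N|N /andP[NM _]].
  by rewrite gpre eqxx andbT imS.
rewrite imS // in NM.
have -> : Gv :\: g @: N = g @: (M :\: N).
  apply/setP => e; apply/setDP/imsetP => [[/imsetP[u uM ->]]|[u]].
    by rewrite mem_imset // => uN; exists u; rewrite // inE uN.
  by rewrite inE => /andP[uN uM] ->; rewrite !mem_imset.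
rewrite !card_imset //; congr (_ * _).
rewrite [RHS](@Ex_setD _ _ Gv); last first.
  move=> F; congr (nat_of_bool _)%:R; apply: explored_local => a b aX bX.
  rewrite /adj inE (_ : _ \notin Gv) //; apply/imsetP => -[u _ /setP/(_ v)].
  rewrite !inE eqxx /= => /orP[/eqP va|/eqP vb].
    move: aX; rewrite -va !inE eqxx (negbTE vD) /= andbF orbF.
    by move=> /(subsetP NM); rewrite inE (negbTE vD).
  by move: bX; rewrite -vb inE (negbTE vD) andbF.
apply: eq_Ex => F2 F2G; congr (nat_of_bool _)%:R; rewrite /= pQ.
have -> : nbrs (g @: N :|: F2) v D = N.
  apply/setP => u; rewrite inE /adj inE -[[set v; u]]/(g u) mem_imset //.
  have [uD|uD] /= := boolP (u \in D); last first.
    by apply/esym/negbTE; apply: contra uD => /(subsetP NM); rewrite inE => /andP[].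
  case: (boolP (u \in N)) => //= uN; apply/negP => /(subsetP F2G).
  rewrite inE mem_imset // => /andP[]; rewrite inE uD /= => h h'.
  by rewrite /adj h' in h.
apply: explored_local => a b aX bX; rewrite /adj inE.
rewrite (_ : _ \in g @: N = false) //; apply/imsetP => -[u _ /setP/(_ v)].
rewrite !inE eqxx /= => /orP[/eqP va|/eqP vb].
  move: aX; rewrite -va !inE eqxx (negbTE vD) /= andbF orbF.
  by move=> /(subsetP NM); rewrite inE (negbTE vD).
by move: bX; rewrite -vb inE (negbTE vD) andbF.
Qed.

End Exploration.

(** * The Borel distribution *)

Section Borel.
Variable R : realType.
Implicit Types (x y p : R).

(** The number exp(- k x) * borel k j x is the probability that the total progeny of j
individuals equals k in a branching process with Poisson(x) offspring, computed individual
by individual; borel itself carries no exponential factor, so that only polynomials in x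
occur. *)
Fixpoint borel (k j : nat) x : R :=
  match k, j with
  | 0, 0 => 1
  | k'.+1, j'.+1 => \sum_(s < k'.+1) x ^+ s / s`!%:R * borel k' (j' + s) x
  | _, _ => 0
  end.

Lemma borel_big k j x : (k < j)%N -> borel k j x = 0.
Proof.
elim: k j => [|k ih] [|j] //= kj; apply: big1 => s _.
by rewrite ih ?mulr0 //; apply: leq_trans (leq_addr _ _); exact: kj.
Qed.

Lemma borel_ge0 k j x : 0 <= x -> 0 <= borel k j x.
Proof.
move=> x0; elim: k j => [|k ih] [|j] //=; apply: sumr_ge0 => s _.
by rewrite mulr_ge0 // divr_ge0 // exprn_ge0.
Qed.

Lemma fact_neq0 k : (k`!%:R : R) != 0.
Proof. by rewrite pnatr_eq0 -lt0n fact_gt0. Qed.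

Lemma sum_mul_bin m (y : R) :
  \sum_(s < m.+1) s%:R * 'C(m, s)%:R * y ^+ (m - s) = m%:R * (y + 1) ^+ m.-1.
Proof.
case: m => [|m]; first by rewrite big_ord_recl big_ord0 !mul0r addr0.
rewrite big_ord_recl !mul0r add0r exprDn mulr_sumr; apply: eq_bigr => s _.
rewrite lift0 subSS expr1n mulr1 -[X in _ = _ * X]mulr_natr -natrM.
by rewrite -mul_bin_diag /= natrM; ring.
Qed.

(** The hitting time theorem for Poisson steps.  The induction step is the binomial
theorem together with its derivative [sum_mul_bin]; the factor k is kept on the left to
avoid a division by zero at k = 0. *)
Lemma borelE k j x : (j <= k)%N ->
  k%:R * borel k j x = j%:R * (k%:R * x) ^+ (k - j) / (k - j)`!%:R.
Proof.
elim: k j => [|k ih] j; first by rewrite leqn0 => /eqP ->; rewrite !mul0r.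
case: j => [|j]; first by rewrite /= mulr0 !mul0r.
rewrite ltnS => jk; rewrite subSS.
have [k0|k0] := posnP k.
  move: jk; rewrite k0 leqn0 => /eqP ->.
  by rewrite /= big_ord_recl big_ord0 /= fact0 !expr0; field.
have kn0 : (k%:R : R) != 0 by rewrite pnatr_eq0 -lt0n.
apply: (mulfI kn0); rewrite mulrCA [borel _ _ _]/= mulr_sumr.
set m := (k - j)%N.
have km : k = (j + m)%N by rewrite /m subnKC.
rewrite (_ : \sum_(i < _) _ = x ^+ m / m`!%:R *
    \sum_(s < m.+1) ((j%:R + s%:R) * 'C(m, s)%:R * k%:R ^+ (m - s))).
  rewrite (eq_bigr (fun s : 'I_m.+1 => j%:R * (k%:R ^+ (m - s) * 1 ^+ s *+ 'C(m, s))
      + s%:R * 'C(m, s)%:R * k%:R ^+ (m - s))); last first.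
    by move=> s _; rewrite expr1n mulr1 -[_ *+ _]mulr_natr; ring.
  rewrite big_split /= -mulr_sumr -exprDn sum_mul_bin natr1.
  rewrite exprMn; case: m km => [|m] km /=.
    by rewrite !expr0 mul0r addr0 mulr1 km addn0 -[j.+1%:R]natr1; ring.
  have -> : (k%:R : R) = j%:R + m.+1%:R by rewrite km natrD.
  have -> : (k.+1%:R : R) = j%:R + m.+1%:R + 1 by rewrite -natr1 km natrD.
  by rewrite !exprS -[j.+1%:R]natr1; ring.
rewrite mulr_sumr (big_ord_widen_cond k.+1 predT
  (fun s => x ^+ m / m`!%:R * ((j%:R + s%:R) * 'C(m, s)%:R * k%:R ^+ (m - s)))); last first.
  by rewrite ltnS leq_subr.
rewrite [RHS]big_mkcond /=; apply: eq_bigr => s _; case: ifPn => sm; last first.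
  by rewrite borel_big ?mulr0 //; lia.
rewrite mulrCA ih; last by lia.
have -> : (k - (j + s) = m - s)%N by lia.
have sm' : (s <= m)%N by [].
have := congr1 (fun z => z%:R : R) (bin_fact sm'); rewrite !natrM => <-.
have -> : x ^+ m = x ^+ s * x ^+ (m - s) by rewrite -exprD subnKC.
rewrite exprMn natrD; field.
rewrite !fact_neq0 pnatr_eq0 -lt0n bin_gt0 //.
Qed.

Lemma borel1E k x : borel k.+1 1 x = (k.+1%:R * x) ^+ k / k.+1`!%:R.
Proof.
have kn0 : (k.+1%:R : R) != 0 by rewrite pnatr_eq0.
apply: (mulfI kn0); rewrite borelE // mul1r subn1 /= factS natrM.
by field; rewrite fact_neq0 nat1r kn0.
Qed.

Lemma bin_le_pow d s : 'C(d, s)%:R <= d%:R ^+ s / s`!%:R :> R.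
Proof.
rewrite ler_pdivlMr ?ltr0n ?fact_gt0 // -natrM bin_ffact -natrX ler_nat.
elim: s d => [|s ih] d; first by rewrite ffactn0 expn0.
case: d => [|d]; first by rewrite ffact0n.
rewrite ffactnS expnS leq_mul2l /=; apply: leq_trans (ih d) _.
by case: (s) => [|s']; rewrite ?expn0 // leq_exp2r.
Qed.

Lemma pow_le_bin d s : (s <= d)%N -> (d - s)%:R ^+ s / s`!%:R <= 'C(d, s)%:R :> R.
Proof.
move=> sd; rewrite ler_pdivrMr ?ltr0n ?fact_gt0 // -natrM bin_ffact -natrX ler_nat.
elim: s d sd => [|s ih] d; first by rewrite ffactn0 expn0.
case: d => // d; rewrite ltnS => sd; rewrite ffactnS expnS subSS.
by apply: leq_mul; [lia|exact: ih].
Qed.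

End Borel.

(** * Component sizes in regular graphs *)

Section ComponentSize.
Import mathcomp.boot.fintype mathcomp.boot.finset.
Local Open Scope set_scope.
Variables (R : realType) (n : nat) (G : {set {set 'I_n}}) (r : nat).
Hypothesis reg : forall v, #|nbrs G v setT| = r.
Implicit Types (p : R) (Q D : {set 'I_n}).

Lemma card_nbrs_le v D : (#|nbrs G v D| <= r)%N.
Proof.
rewrite -(reg v); apply: subset_leq_card.
by apply/subsetP => u; rewrite !inE => /andP[_ ->].
Qed.

Lemma card_nbrs_ge v D : (r <= #|nbrs G v D| + #|~: D|)%N.
Proof.
rewrite -(reg v) (_ : nbrs G v setT = nbrs G v D :|: nbrs G v (~: D)).
  apply: leq_trans (leq_card_setU _ _) _; rewrite leq_add2l.
  by apply: subset_leq_card; apply/subsetP => u; rewrite inE => /andP[].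
by apply/setP => u; rewrite !inE; case: (u \in D); rewrite ?orbF.
Qed.

(** With at most k0 vertices ever touched, an active vertex has between r - k0 and r
untouched neighbours.  The binomial law of the number of its newly activated neighbours is
then compared term by term with the weights of [borel].  The invariant on cardinals says
that the number of touched vertices at the end is at most k0. *)
Lemma explored_bounds p k0 k Q D : 0 <= p <= 1 -> (2 * k0 <= r)%N ->
  [disjoint Q & D] -> (#|~: D| + k <= k0 + #|Q|)%N ->
  borel k #|Q| ((r - 2 * k0)%:R * p) * (1 - p) ^+ (k * r) <=
    Ex G p (fun F => (explored F k Q D)%:R) <=
  borel k #|Q| (r%:R * p) * (1 - p) ^+ (k * (r - 2 * k0)).
Proof.
move=> p01 k0r; have /andP[p0 p1] := p01; have q0 : 0 <= 1 - p by rewrite subr_ge0.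
have q1 : 1 - p <= 1 by rewrite gerBl.
elim: k Q D => [|k ih] Q D dQD hk.
  rewrite !mul0n !expr0 !mulr1 /= Ex_const -cards_eq0.
  by case: #|Q| => [|j] /=; rewrite lexx.
have [Q0|Qn0] := eqVneq #|Q| 0%N.
  have -> : Q = set0 by apply/eqP; rewrite -cards_eq0 Q0.
  rewrite cards0 /= !mul0r; rewrite [X in _ <= X <= _](_ : _ = 0) ?lexx //.
  rewrite -[RHS](Ex_const G p 0); apply: eq_Ex => F _; case: pickP => // x.
  by rewrite inE.
have [v pv] : exists v, [pick v in Q] = Some v.
  case: pickP => [v _|h]; first by exists v.
  by case/eqP: Qn0; apply: eq_card0 => x; rewrite h.
have vQ : v \in Q by move: pv; case: pickP => // x xQ [<-].
have vD : v \notin D by rewrite (disjointFr dQD).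
rewrite (Ex_explored _ _ _ pv vD); set M := nbrs G v D.
have MD : M \subset D by apply/subsetP => u; rewrite inE => /andP[].
case cQ : #|Q| Qn0 => [//|j] _.
have QD : (#|Q| <= #|~: D|)%N.
  by rewrite subset_leq_card // -disjoints_subset.
have kk0 : (k < k0)%N by move: hk QD; clear; lia.
have Mr : (#|M| <= r)%N by exact: card_nbrs_le.
have rM : (r <= #|M| + #|~: D|)%N by exact: card_nbrs_ge.
(* If j > k the exploration cannot stop in time and both sides vanish. *)
have MQD : (j <= k -> r <= #|M| + k0)%N.
  by move: hk QD rM cQ; clear; lia.
have cQ' (N : {set 'I_n}) : N \subset M -> #|Q :\ v :|: N| = (j + #|N|)%N.
  move=> NM; rewrite cardsU (_ : _ :&: N = set0).
    by rewrite cards0 subn0; congr addn; move: cQ; rewrite (cardsD1 v) vQ; clear; lia.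
  apply/eqP; rewrite setI_eq0; apply: (disjointWl (subsetDl _ _)).
  exact: (disjointWr (subset_trans NM MD)).
have dQ' (N : {set 'I_n}) : N \subset M -> [disjoint Q :\ v :|: N & D :\: N].
  move=> NM; rewrite -setI_eq0; apply/eqP/setP => x; rewrite !inE.
  case: (x \in N) => /=; rewrite ?andbF // orbF.
  by case: (boolP (x \in Q)) => [/(disjointFr dQD) ->|_]; rewrite ?andbF.
have cD' (N : {set 'I_n}) : N \subset M -> #|~: (D :\: N)| = (#|~: D| + #|N|)%N.
  move=> NM; rewrite setCD cardsU (_ : ~: D :&: N = set0) ?cards0 ?subn0 //.
  apply/eqP; rewrite setI_eq0 disjoint_sym disjoints_subset setCK.
  exact: subset_trans NM MD.
set x := (r - 2 * k0)%:R * p; set y := r%:R * p.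
have x0 : 0 <= x by rewrite mulr_ge0.
have y0 : 0 <= y by rewrite mulr_ge0.
pose W s := p ^+ s * (1 - p) ^+ (#|M| - s).
have W0 s : 0 <= W s by rewrite mulr_ge0 ?exprn_ge0.
have sumW (f : nat -> R) : (forall s, (k < s)%N -> f s = 0) ->
    \sum_(N : {set 'I_n} | N \subset M) p ^+ #|N| * (1 - p) ^+ #|M :\: N| * f #|N|
    = \sum_(s < k.+1) 'C(#|M|, s)%:R * (W s * f s).
  move=> f0; rewrite (eq_bigr (fun N : {set 'I_n} => W #|N| * f #|N|)); last first.
    by move=> N NM; rewrite /W cardsD (setIidPr NM).
  rewrite (sum_subsets_card M (fun s => W s * f s)).
  rewrite (big_ord_widen (#|M|.+1 + k)%N (fun s => 'C(#|M|, s)%:R * (W s * f s))) ?leq_addr //.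
  rewrite [RHS](big_ord_widen (#|M|.+1 + k)%N (fun s => 'C(#|M|, s)%:R * (W s * f s))) ?leq_addl //; last by clear; lia.
  rewrite big_mkcond [RHS]big_mkcond /=; apply: eq_bigr => s _.
  case: ifPn => h1; case: ifPn => h2 //; first by rewrite f0 ?mulr0 //; move: h2; clear; lia.
  by rewrite bin_small ?mul0r //; move: h1; clear; lia.
have ih' (N : {set 'I_n}) : N \subset M ->
    borel k (j + #|N|) x * (1 - p) ^+ (k * r) <=
    Ex G p (fun F => (explored F k (Q :\ v :|: N) (D :\: N))%:R) <=
    borel k (j + #|N|) y * (1 - p) ^+ (k * (r - 2 * k0)).
  by move=> NM; rewrite -(cQ' _ NM); apply: ih; [exact: dQ'|rewrite cD' // cQ' //; move: hk cQ; clear; lia].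
have p1M s : 0 <= p ^+ s * (1 - p) ^+ (#|M| - s) by rewrite mulr_ge0 ?exprn_ge0.
have pow_mono a b : (a <= b)%N -> (1 - p) ^+ b <= (1 - p) ^+ a.
  by move=> ab; rewrite ler_wiXn2l.
apply/andP; split.
- apply: le_trans (_ : \sum_(N : {set 'I_n} | N \subset M)
      p ^+ #|N| * (1 - p) ^+ #|M :\: N| * (borel k (j + #|N|) x * (1 - p) ^+ (k * r)) <= _); last first.
    apply: ler_sum => N NM; rewrite ler_wpM2l ?mulr_ge0 ?exprn_ge0 //.
    by have /andP[] := ih' _ NM.
  rewrite (sumW (fun s => borel k (j + s) x * (1 - p) ^+ (k * r))); last first.
    by move=> s ks; rewrite borel_big ?mul0r //; move: ks; clear; lia.
  rewrite /= mulr_suml; apply: ler_sum => s _.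
  have [jk|kj] := leqP (j + s) k; last by rewrite borel_big // !(mul0r, mulr0).
  have rMk : (r <= #|M| + k0)%N by apply: MQD; move: jk; clear; lia.
  rewrite mulSn exprD.
  rewrite (_ : _ * _ = (x ^+ s / s`!%:R * (1 - p) ^+ r) * (borel k (j + s) x * (1 - p) ^+ (k * r))); last by ring.
  rewrite [X in _ <= X]mulrA ler_wpM2r ?mulr_ge0 ?exprn_ge0 ?borel_ge0 //.
  rewrite /W mulrA; apply: ler_pM; rewrite ?mulr_ge0 ?exprn_ge0 ?invr_ge0 //; last first.
    by apply: pow_mono; move: jk kk0 rMk Mr k0r; clear; lia.
  rewrite /x exprMn mulrAC ler_wpM2r ?exprn_ge0 //.
  apply: le_trans (pow_le_bin _ (_ : (s <= #|M|)%N)); last by move: jk kk0 rMk k0r; clear; lia.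
  by rewrite ler_wpM2r ?invr_ge0 // lerXn2r ?nnegrE // ler_nat; move: jk kk0 rMk k0r; clear; lia.
- apply: le_trans (_ : _ <= \sum_(N : {set 'I_n} | N \subset M)
      p ^+ #|N| * (1 - p) ^+ #|M :\: N| * (borel k (j + #|N|) y * (1 - p) ^+ (k * (r - 2 * k0)))) _.
    apply: ler_sum => N NM; rewrite ler_wpM2l ?mulr_ge0 ?exprn_ge0 //.
    by have /andP[] := ih' _ NM.
  rewrite (sumW (fun s => borel k (j + s) y * (1 - p) ^+ (k * (r - 2 * k0)))); last first.
    by move=> s ks; rewrite borel_big ?mul0r //; move: ks; clear; lia.
  rewrite /= mulr_suml; apply: ler_sum => s _.
  have [jk|kj] := leqP (j + s) k; last by rewrite borel_big // !(mul0r, mulr0).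
  have rMk : (r <= #|M| + k0)%N by apply: MQD; move: jk; clear; lia.
  rewrite mulSn exprD.
  rewrite [X in _ <= X](_ : _ = (y ^+ s / s`!%:R * (1 - p) ^+ (r - 2 * k0)) * (borel k (j + s) y * (1 - p) ^+ (k * (r - 2 * k0)))); last by ring.
  rewrite [X in X <= _]mulrA ler_wpM2r ?mulr_ge0 ?exprn_ge0 ?borel_ge0 //.
  rewrite /W mulrA; apply: ler_pM; rewrite ?mulr_ge0 ?exprn_ge0 ?invr_ge0 //; last first.
    by apply: pow_mono; move: jk kk0 rMk Mr k0r; clear; lia.
  rewrite /y exprMn mulrAC ler_wpM2r ?exprn_ge0 //.
  apply: le_trans (bin_le_pow _ _ _) _.
  by rewrite ler_wpM2r ?invr_ge0 // lerXn2r ?nnegrE // ler_nat.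
Qed.

(** The exploration started at v with all other vertices untouched. *)
Lemma component_size_bounds p k v : 0 <= p <= 1 -> (0 < k)%N -> (2 * k <= r)%N ->
  (k%:R * ((r - 2 * k)%:R * p)) ^+ k.-1 / k`!%:R * (1 - p) ^+ (k * r) <=
    Ex G p (fun F => (#|component F v| == k)%:R) <=
  (k%:R * (r%:R * p)) ^+ k.-1 / k`!%:R * (1 - p) ^+ (k * (r - 2 * k)).
Proof.
case: k => // k p01 _ kr.
have -> : Ex G p (fun F => (#|component F v| == k.+1)%:R) =
    Ex G p (fun F => (explored F k.+1 [set v] (~: [set v]))%:R).
  by apply: eq_Ex => F _; rewrite explored_component.
have := @explored_bounds p k.+1 k.+1 [set v] (~: [set v]) p01 kr.
rewrite cards1 !borel1E; apply; first by rewrite -setI_eq0 setICr eqxx.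
by rewrite setCK cards1 addnC.
Qed.

End ComponentSize.

Section Degree.
Import mathcomp.boot.fintype mathcomp.boot.finset.
Local Open Scope set_scope.
Variables (n : nat).

Lemma card_nbrs_degree (G : {set {set 'I_n}}) v : G \subset complete_graph n ->
  #|nbrs G v setT| = degree G v.
Proof.
move=> sub; rewrite /degree.
have ginj : {in nbrs G v setT &, injective (fun u => [set v; u])}.
  move=> u w uN _ /setP e; have := e u; have := e w; rewrite !in_set2 !eqxx !orbT.
  move=> /orP[/eqP wv|/eqP //] /esym/orP[/eqP ->|/eqP //].
  by rewrite wv.
rewrite -(card_in_imset ginj); apply: eq_card => e; rewrite inE.
apply/imsetP/andP => [[u uN ->]|[eG ve]].
  by move: uN; rewrite !inE => /andP[_ h]; rewrite eqxx.
have [x [y [xy exy]]] := complete_graphP (subsetP sub _ eG).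
move: ve; rewrite exy !inE => /orP[/eqP vx|/eqP vy].
  by exists y; rewrite ?inE /adj vx -exy.
by exists x; rewrite ?inE /adj vy ?[[set y; x]]setUC -exy.
Qed.

End Degree.

(** * Tree weights as integrals *)

Section UniformCdf.
Local Open Scope classical_set_scope.
Local Open Scope ring_scope.
Variable R : realType.
Local Notation mu := (@lebesgue_measure R).

Lemma uniform_le (p : R) : 0 <= p <= 1 ->
  uniform_prob (@ltr01 R) [set` `]-oo, p] ] = p%:E.
Proof.
move=> /andP[p0 p1]; rewrite /uniform_prob integral_uniform_pdf.
have -> : [set` `]-oo, p] ] `&` [set` `[0, 1] ] = [set` `[0, p] ] :> set R.
  apply/seteqP; split => x /=; rewrite !in_itv /=.
    by move=> [-> /andP[-> _]].
  by move=> /andP[-> xp]; rewrite xp (le_trans xp p1).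
rewrite (eq_integral (fun=> 1%E)); last first.
  move=> x; rewrite inE /= in_itv /= => /andP[x0 xp].
  by rewrite /uniform_pdf x0 (le_trans xp p1) subr0 invr1.
rewrite integral_cst //= mul1e lebesgue_measure_itv /= lte_fin.
case: ifPn => [_|]; first by rewrite -EFinD subr0.
by rewrite -leNgt => pn; congr _%:E; apply/eqP; rewrite eq_le p0 pn.
Qed.

Lemma uniform_gt (p : R) : 0 <= p <= 1 ->
  uniform_prob (@ltr01 R) [set` `]p, +oo[ ] = (1 - p)%:E.
Proof.
move=> p01; rewrite -setCitvl probability_setC; last exact: measurable_itv.
by rewrite EFinB -(uniform_le p01).
Qed.

Lemma uniform_01 : uniform_prob (@ltr01 R) [set` `[0, 1] ] = 1%E.
Proof. by rewrite /uniform_prob integral_uniform_pdf1. Qed.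

Lemma integral_indic_lt (w : R) : 0 <= w <= 1 ->
  (\int[mu]_(p in `[0%R, 1%R]) (\1_[set` `]-oo, w[ ] p)%:E = w%:E)%E.
Proof.
move=> /andP[w0 w1]; rewrite integral_indic //=.
have -> : [set` `]-oo, w[ ] `&` [set` `[0, 1] ] = [set` `[0, w[ ] :> set R.
  apply/seteqP; split => x /=; rewrite !in_itv /=.
    by move=> [-> /andP[-> _]].
  by move=> /andP[-> xp]; rewrite xp (le_trans (ltW xp) w1).
rewrite [LHS]lebesgue_measure_itv /= lte_fin.
case: ifPn => [_|]; first by rewrite -EFinD subr0.
by rewrite -leNgt => pn; congr _%:E; apply/eqP; rewrite eq_le w0 pn.
Qed.

Lemma card_above (I : finType) (T : {set I}) (w : I -> R) (p : R) :
  #|[set e in T | p < w e]%SET|%:R = \sum_(e <- enum T) \1_[set` `]-oo, w e[ ] p :> R.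
Proof.
rewrite big_enum /= -sum1_card natr_sum big_mkcond [RHS]big_mkcond /=.
apply: eq_bigr => e _; rewrite inE; case: (e \in T) => //=.
rewrite indicE mem_setE in_itv /=; by case: (p < w e).
Qed.

Lemma integral_card_above (I : finType) (T : {set I}) (w : I -> R) :
  (forall e, e \in T -> 0 <= w e <= 1) ->
  (\int[mu]_(p in `[0%R, 1%R]) (#|[set e in T | (p < w e)%R]%SET|%:R)%:E
   = (\sum_(e in T) w e)%:E)%E.
Proof.
move=> w01.
under eq_integral do rewrite card_above -sumEFin.
rewrite ge0_integral_sum //=.
- rewrite big_enum /= -sumEFin; apply: eq_bigr => e eT.
  by rewrite integral_indic_lt // w01.
- move=> e; apply/measurable_EFinP; apply: measurable_indic.
  exact: measurable_itv.
Qed.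

Lemma measurable_card_above (I : finType) (T : {set I}) (w : I -> R) (D : set R) :
  measurable_fun D (fun p => (#|[set e in T | p < w e]%SET|%:R)%:E : \bar R).
Proof.
apply/measurable_EFinP.
under eq_fun do rewrite card_above.
apply: measurable_sum => e; apply: measurable_indic.
exact: measurable_itv.
Qed.

End UniformCdf.

Section MinTree.
Local Open Scope classical_set_scope.
Local Open Scope ring_scope.
Variables (R : realType) (n : nat).
Local Notation mu := (@lebesgue_measure R).
Implicit Types (w : {set 'I_n} -> R) (H T : {set {set 'I_n}}).
Hypothesis n0 : (0 < n)%N.

Definition spanning_trees H : set {set {set 'I_n}} := [set T | spanning_tree H T].

(** The infimum is taken over finitely many trees, hence attained. *)
Lemma min_tree_attained w H : spanning_trees H !=set0 ->
  exists2 T, spanning_trees H T & min_tree_weight H w = \sum_(e in T) w e /\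
    forall T', spanning_trees H T' -> \sum_(e in T) w e <= \sum_(e in T') w e.
Proof.
move=> [T0 tT0].
have [T /asboolP tT minT] := @arg_minP _ R _ T0 (fun T => `[< spanning_trees H T >])
  (fun T => \sum_(e in T) w e) (asboolT tT0).
have minT' T' : spanning_trees H T' -> \sum_(e in T) w e <= \sum_(e in T') w e.
  by move=> tT'; apply: minT; exact/asboolP.
exists T => //; split => //; apply/eqP; rewrite eq_le; apply/andP; split.
  apply: ge_inf; last by exists T.
  by exists (\sum_(e in T) w e) => _ [T' tT' <-]; exact: minT'.
apply: lb_le_inf; first by exists (\sum_(e in T) w e); exists T.
by move=> _ [T' tT' <-]; exact: minT'.
Qed.

Lemma trees_nonempty H : H \subset complete_graph n -> connected_graph H ->
  spanning_trees H !=set0.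
Proof.
by move=> sub cH; have [T tT _] := optimal_tree (fun=> 0 : R) n0 sub cH; exists T.
Qed.

(** The tree of Kruskal's algorithm minimises the number of edges heavier than p
simultaneously for all p, hence it minimises the integral of that number, which is its
weight. *)
Lemma min_tree_integral w H : H \subset complete_graph n -> connected_graph H ->
  (forall e, e \in H -> 0 <= w e <= 1) ->
  ((min_tree_weight H w)%:E =
   \int[mu]_(p in `[0%R, 1%R]) ((kappa [set e in H | (w e <= p)%R]%SET)%:R - 1)%:E)%E.
Proof.
move=> sub cH w01.
have [T tT minT] := min_tree_attained w (trees_nonempty sub cH).
have [T' tT' kT'] := optimal_tree w n0 sub cH.
have [TH cT _] := tT; have [TH' _ _] := tT'.
have eT' p : (kappa [set e in H | w e <= p]%SET)%:R - 1 = #|[set e in T' | p < w e]%SET|%:R :> R.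
  by rewrite -kT' -natr1 addrK.
have wT : forall e, e \in T -> 0 <= w e <= 1.
  by move=> e /(fintype.subsetP TH); exact: w01.
have wT' : forall e, e \in T' -> 0 <= w e <= 1.
  by move=> e /(fintype.subsetP TH'); exact: w01.
under eq_integral do rewrite eT'.
rewrite integral_card_above //.
have [-> le] := minT; apply/eqP; rewrite eq_le lee_fin le //=.
rewrite -(integral_card_above wT) -(integral_card_above wT').
apply: ge0_le_integral => //=.
- exact: measurable_card_above.
- exact: measurable_card_above.
- move=> p _; rewrite lee_fin -eT' lerBlDr natr1 ler_nat.
  exact: connected_above.
Qed.

End MinTree.

(** * The expected minimum as an integral *)

Section Mst.
Local Open Scope classical_set_scope.
Local Open Scope ring_scope.
Variables (R : realType) (n : nat) (d : measure_display) (Omega : measurableType d).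
Variables (P : probability Omega R) (W : {set 'I_n} -> {RV P >-> R}).
Hypothesis n0 : (0 < n)%N.
Hypothesis iidW : iid_uniform_weights W.
Variable H : {set {set 'I_n}}.
Hypothesis subH : H \subset complete_graph n.
Local Notation mu := (@lebesgue_measure R).

Definition below (p : R) (x : Omega) : {set {set 'I_n}} := [set e in H | W e x <= p]%SET.

Lemma weight_prob e B : e \in H -> measurable B ->
  P (W e @^-1` B) = uniform_prob (@ltr01 R) B.
Proof.
move=> eH mB; have [h _] := iidW.
exact: (h e B (fintype.subsetP subH _ eH) mB).
Qed.

Lemma weights_ae : \forall x \ae P, forall e, e \in H -> 0 <= W e x <= 1.
Proof.
suff h e : \forall x \ae P, e \in H -> 0 <= W e x <= 1 by exact: filter_forall.
have [eH|_] := boolP (e \in H); last by apply: aeW.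
exists (~` (W e @^-1` [set` `[0, 1] ])); split.
- by apply: measurableC; rewrite -[X in measurable X]setTI; apply: measurable_funP.
- rewrite probability_setC; last by rewrite -[X in measurable X]setTI; apply: measurable_funP.
  by rewrite weight_prob // uniform_01 subee.
- move=> x /= h; apply: contra_not h => /=; rewrite in_itv /= => h _; exact: h.
Qed.

Lemma below_event p (F : {set {set 'I_n}}) : F \subset H ->
  [set x | below p x = F] =
  [set x | forall e, e \in H -> (if e \in F then [set` `]-oo, p] ] else [set` `]p, +oo[ ]) (W e x)].
Proof.
move=> FH; apply/seteqP; split => x /=.
  move=> <- e eH; rewrite inE eH /=; case: ifP; rewrite /= in_itv /= ?andbT //.
  by rewrite ltNge => ->.
move=> h; apply/setP => e; rewrite inE.
have [eH|eH] := boolP (e \in H) => /=.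
  have := h e eH; case: (e \in F); rewrite /= in_itv /= ?andbT //.
  by rewrite ltNge => /negbTE.
by apply/esym/negbTE; apply: contra eH => /(fintype.subsetP FH).
Qed.

(** Mutual independence of the weights is applied to all edges of H at once: an edge of F
must fall in the half line up to p, any other edge in its complement. *)
Lemma below_prob p (F : {set {set 'I_n}}) : 0 <= p <= 1 -> F \subset H ->
  P [set x | below p x = F] = (p ^+ #|F| * (1 - p) ^+ #|H :\: F|%SET)%:E.
Proof.
move=> p01 FH; rewrite below_event //.
have [_ ind] := iidW.
rewrite (ind H (fun e => if e \in F then [set` `]-oo, p] ] else [set` `]p, +oo[ ])) //; last by move=> e; case: ifP => _; exact: measurable_itv.
rewrite (bigID (mem F)) /= EFinM; congr (_ * _)%E.
  rewrite (eq_big (mem F) (fun=> p%:E)); last 2 first.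
  - move=> e /=; rewrite andb_idl //; exact: (fintype.subsetP FH).
  - by move=> e /andP[eH ->]; rewrite weight_prob ?uniform_le //; exact: measurable_itv.
  by rewrite prodEFin prodr_const.
rewrite (eq_big (mem (H :\: F)%SET) (fun=> (1 - p)%:E)); last 2 first.
- by move=> e /=; rewrite inE andbC.
- by move=> e /andP[eH /negbTE ->]; rewrite weight_prob ?uniform_gt //; exact: measurable_itv.
by rewrite prodEFin prodr_const.
Qed.

Lemma below_joint_measurable (F : {set {set 'I_n}}) :
  measurable [set xp : Omega * R | below xp.2 xp.1 = F].
Proof.
have [FH|FH] := boolP (F \subset H); last first.
  rewrite (_ : [set _ | _] = set0) //; apply/seteqP; split => // -[x p] /= e.
  by case/negP: FH; rewrite -e; apply/fintype.subsetP => f; rewrite inE => /andP[].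
rewrite (_ : [set _ | _] = \bigcap_(e in [set e | e \in H])
   [set xp : Omega * R | (W e xp.1 <= xp.2) = (e \in F)]).
  apply: fin_bigcap_measurable => // e _.
  have mf : measurable_fun setT (fun xp : Omega * R => (W e xp.1 <= xp.2)).
    apply: measurable_fun_ler; last exact: measurable_snd.
    by apply: measurableT_comp => //; exact: measurable_fst.
  by have := mf measurableT [set e \in F]; rewrite setTI; apply.
apply/seteqP; split => -[x p] /=.
  by move=> <- e /= eH; rewrite inE eH.
move=> h; apply/setP => e; rewrite inE.
have [eH|eH] := boolP (e \in H) => /=; first exact: (h e eH).
by apply/esym/negbTE; apply: contra eH => /(fintype.subsetP FH).
Qed.

Lemma below_sub p x : below p x \subset H.
Proof. by apply/fintype.subsetP => f; rewrite inE => /andP[]. Qed.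

Lemma below_decomp (phi : {set {set 'I_n}} -> R) p x :
  phi (below p x) =
  \sum_(F : {set {set 'I_n}}) phi F * \1_[set xp : Omega * R | below xp.2 xp.1 = F] (x, p).
Proof.
rewrite (bigD1 (below p x)) //= big1 ?addr0.
  by rewrite indicE mem_set // mulr1.
move=> F neF; rewrite indicE memNset ?mulr0 //= => e.
by rewrite e eqxx in neF.
Qed.

Lemma below_measurable p (F : {set {set 'I_n}}) : measurable [set x | below p x = F].
Proof.
have := measurable_ysection p (below_joint_measurable F).
by rewrite /ysection; congr measurable; apply/seteqP; split => x /=; rewrite inE.
Qed.

Lemma integral_below (phi : {set {set 'I_n}} -> R) p : 0 <= p <= 1 ->
  (forall F, 0 <= phi F) ->
  (\int[P]_x (phi (below p x))%:E = (Ex H p phi)%:E)%E.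
Proof.
move=> p01 phi0.
have -> : (fun x => (phi (below p x))%:E) = (fun x => \sum_(F : {set {set 'I_n}})
    (phi F)%:E * (\1_[set x | below p x = F] x)%:E)%E.
  apply/funext => x; rewrite below_decomp -sumEFin; apply: eq_bigr => F _.
  by rewrite EFinM !indicE; congr (_ * _%:R%:E)%E; congr nat_of_bool; apply/idP/idP; rewrite !inE.
rewrite ge0_integral_sum //=; last 2 first.
- move=> F; apply: emeasurable_funM => //; apply/measurable_EFinP.
  by apply: measurable_indic; exact: below_measurable.
- by move=> F x _; rewrite mule_ge0 ?lee_fin // phi0.
rewrite /Ex [in RHS]big_mkcond /= -sumEFin; apply: eq_bigr => F _.
rewrite ge0_integralZl_EFin //=; last first.
- by apply/measurable_EFinP; apply: measurable_indic; exact: below_measurable.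
rewrite integral_indic //; last exact: below_measurable.
rewrite setIT; case: ifPn => FH; first by rewrite [X in (_ * X)%E](below_prob p01 FH) -EFinM mulrC.
rewrite (_ : [set _ | _] = set0) ?measure0 ?mule0 //.
apply/seteqP; split => // x /= e.
by rewrite -e below_sub in FH.
Qed.

Lemma joint_measurable (phi : {set {set 'I_n}} -> R) :
  measurable_fun setT (fun xp : Omega * R => phi (below xp.2 xp.1)).
Proof.
have -> : (fun xp : Omega * R => phi (below xp.2 xp.1)) =
    (fun xp => \sum_(F : {set {set 'I_n}}) phi F *
      \1_[set xp : Omega * R | below xp.2 xp.1 = F] xp).
  by apply/funext => -[x p] /=; rewrite below_decomp.
apply: measurable_sum => F; apply: measurable_funM => //.
by apply: measurable_indic; exact: below_joint_measurable.
Qed.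

Hypothesis cH : connected_graph H.

Lemma measurable_min_tree :
  measurable_fun setT (fun x => min_tree_weight H (fun e => W e x)).
Proof.
move=> _; apply: (measurability _ (RGenInftyO.measurableE R)) => //.
move=> /= _ [_ [a ->] <-]; rewrite setTI.
rewrite [X in measurable X](_ : _ = \bigcup_(T in spanning_trees H)
    [set x | \sum_(e <- enum T) W e x < a]).
  apply: fin_bigcup_measurable => // T _.
  have mf : measurable_fun setT (fun x => \sum_(e <- enum T) W e x < a).
    by apply: measurable_fun_ltr => //; exact: measurable_sum.
  by have := mf measurableT [set true]; rewrite setTI; apply.
apply/seteqP; split => x /=; rewrite in_itv /=.
  have [T tT [-> _]] := min_tree_attained (fun e => W e x) (trees_nonempty R n0 subH cH).
  by exists T => //=; rewrite big_enum.
move=> [T tT]; rewrite /= big_enum /= => ltTa.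
have [T' tT' [-> le]] := min_tree_attained (fun e => W e x) (trees_nonempty R n0 subH cH).
exact: le_lt_trans (le T tT) ltTa.
Qed.

(** Fubini's theorem for the pair of the sample point and the threshold p; the pointwise
identity [min_tree_integral] holds almost surely because the weights lie in [0, 1] almost
surely. *)
Lemma mst_integral :
  mst W H = \int[mu]_(p in `[0, 1]) (Ex H p (fun F => (kappa F)%:R) - 1).
Proof.
pose phi (F : {set {set 'I_n}}) : R := (kappa F)%:R - 1.
have phi0 F : 0 <= phi F by rewrite subr_ge0 ler1n kappa_gt0.
have mphi : measurable_fun setT (fun xp : Omega * R => (phi (below xp.2 xp.1) * \1_[set` `[0%R, 1%R] ] xp.2)%:E).
  apply/measurable_EFinP; apply: measurable_funM; first exact: joint_measurable.
  have mi : measurable_fun setT (\1_[set` `[0%R, 1%R] ] : R -> R).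
    by apply: measurable_indic; exact: measurable_itv.
  exact: (measurableT_comp mi measurable_snd).
have phi1 (xp : Omega * R) : (0 <= (phi (below xp.2 xp.1) * \1_[set` `[0%R, 1%R] ] xp.2)%:E)%E.
  by rewrite lee_fin mulr_ge0.
have e1 : ('E_P[fun x => min_tree_weight H (fun e => W e x)] =
   \int[P]_x \int[mu]_p (phi (below p x) * \1_[set` `[0%R, 1%R] ] p)%:E)%E.
  rewrite unlock; apply: ae_eq_integral => //.
  - by apply/measurable_EFinP; exact: measurable_min_tree.
  - exact: (@measurable_fun_fubini_tonelli_F _ _ Omega (measurableTypeR R) R mu _ mphi phi1).
  - apply: filterS weights_ae => x w01 _; rewrite (min_tree_integral n0 subH cH w01).
    rewrite [LHS]integral_mkcond; apply: eq_integral => p _.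
    rewrite /patch indicE; case: ifP => _; first by rewrite mulr1.
    by rewrite mulr0.
have e2 : ('E_P[fun x => min_tree_weight H (fun e => W e x)] =
  \int[mu]_(p in `[0%R, 1%R]) (Ex H p (fun F => (kappa F)%:R) - 1)%:E)%E.
  rewrite e1 (@fubini_tonelli _ _ Omega (measurableTypeR R) R P mu _ mphi phi1) [RHS]integral_mkcond.
  apply: eq_integral => p _; rewrite /patch; case: ifPn => p01; last first.
    by under eq_integral do rewrite indicE (negbTE p01) mulr0; rewrite integral0.
  under eq_integral do rewrite indicE p01 mulr1.
  rewrite inE /= in_itv /= in p01.
  by rewrite integral_below // /phi ExB Ex_const.
by rewrite /mst e2.
Qed.

End Mst.

Section ExIntegrable.
Local Open Scope classical_set_scope.
Local Open Scope ring_scope.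
Variables (R : realType) (I : finType).
Local Notation mu := (@lebesgue_measure R).

Lemma Ex_continuous (E : {set I}) (f : {set I} -> R) : continuous (fun p => Ex E p f).
Proof.
apply: continuous_big => [|F _ p]; first exact: add_continuous.
apply: cvgM; last exact: cvg_cst.
exact: continuous_XMonemX.
Qed.

Lemma continuous_integrable01 (f : R -> R) : continuous f ->
  mu.-integrable `[0, 1] (EFin \o f).
Proof.
move=> cf; apply: continuous_compact_integrable; first exact: segment_compact.
by apply: continuous_in_subspaceT => x _; exact: cf.
Qed.

End ExIntegrable.

(** * Vertex sets left by no edge *)

Section Cuts.
Import mathcomp.boot.fintype mathcomp.boot.finset.
Local Open Scope set_scope.
Variables (R : realType) (n : nat).
Implicit Types (E F G H A : {set {set 'I_n}}) (S D : {set 'I_n}) (p : R).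

Definition boundary E S : {set {set 'I_n}} :=
  [set e in E | (e :&: S != set0) && (e :\: S != set0)].

Lemma boundary_pair E S u v : u \in S -> v \notin S -> adj E u v ->
  [set u; v] \in boundary E S.
Proof.
move=> uS vS uv; rewrite inE [_ \in E]uv /=; apply/andP; split; apply/set0Pn.
  by exists u; rewrite !inE eqxx uS.
by exists v; rewrite !inE eqxx orbT vS.
Qed.

(** An edge leaving S is determined by its endpoint in S and its endpoint outside. *)
Lemma card_boundary_ge E S :
  (\sum_(v in S) #|nbrs E v (~: S)| <= #|boundary E S|)%N.
Proof.
pose Z := [set x : 'I_n * 'I_n | (x.1 \in S) && (x.2 \in nbrs E x.1 (~: S))].
have -> : (\sum_(v in S) #|nbrs E v (~: S)| = #|Z|)%N.
  rewrite -sum1_card (eq_bigr (fun v => \sum_(u in nbrs E v (~: S)) 1)%N); last first.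
    by move=> v _; rewrite sum1_card.
  by rewrite pair_big_dep /=; apply: eq_bigl => -[v u]; rewrite [RHS]inE.
have inj : {in Z &, injective (fun x : 'I_n * 'I_n => [set x.1; x.2])}.
  move=> [a b] [a' b']; rewrite !inE /= => /and3P[aS bS _] /and3P[a'S b'S _] /setP e.
  have aa' : a = a'.
    have := e a; rewrite !inE eqxx /= => /esym/orP[/eqP //|/eqP ab'].
    by rewrite -ab' aS in b'S.
  have := e b; rewrite !inE eqxx orbT /= => /esym/orP[/eqP ba'|/eqP ->]; last by rewrite aa'.
  by rewrite ba' a'S in bS.
rewrite -(card_in_imset inj); apply: subset_leq_card.
apply/subsetP => _ /imsetP[[a b] + ->]; rewrite !inE /= => /and3P[aS bS ab].
by have := boundary_pair aS bS ab; rewrite inE.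
Qed.

Lemma card_boundary_regular G r S : (forall v, #|nbrs G v setT| = r) ->
  (#|S| * (r - #|S|) <= #|boundary G S|)%N.
Proof.
move=> reg; apply: leq_trans (card_boundary_ge _ _).
rewrite -sum_nat_const; apply: leq_sum => v _.
by have := card_nbrs_ge reg v (~: S); rewrite setCK leq_subLR addnC.
Qed.

Lemma card_boundary_complete S :
  (#|S| * (n - #|S|) <= #|boundary (complete_graph n) S|)%N.
Proof.
apply: leq_trans (card_boundary_ge _ _).
rewrite -sum_nat_const; apply: leq_sum => v vS.
have -> : (n - #|S| = #|~: S|)%N by rewrite [RHS]cardsCs setCK card_ord.
apply: subset_leq_card.
apply/subsetP => u; rewrite !inE => uS; rewrite uS /adj inE cards2.
by have -> : v != u by apply: contraNneq uS => <-.
Qed.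

Lemma component_closed F v : F :&: boundary (complete_graph n) (component F v) = set0.
Proof.
apply/setP => e; rewrite in_set0 inE; apply/negbTE/negP => /andP[eF].
rewrite inE => /andP[/complete_graphP[x [y [xy exy]]]] /andP[/set0Pn[a] /[swap] /set0Pn[b]].
rewrite !inE exy !inE => /andP[vb bxy] /andP[axy va].
have ab : connect (adj F) a b.
  case/orP: axy => /eqP ->; case/orP: bxy => /eqP ->; rewrite ?connect0 //; apply: connect1.
    by rewrite /adj -exy.
  by rewrite /adj setUC -exy.
by case/negP: vb; exact: connect_trans ab.
Qed.

Definition closed_in H F S : bool := F :&: boundary H S == set0.

Lemma component_closed_in H F v : H \subset complete_graph n ->
  closed_in H F (component F v).
Proof.
move=> sub; rewrite /closed_in -subset0 -(component_closed F v) setIS //.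
by apply/subsetP => e; rewrite !inE => /andP[/(subsetP sub) + ->]; rewrite inE => ->.
Qed.

(** The sum counts the components of size at most M, and a component is a set that no
present edge leaves. *)
Lemma small_components_le H F M : H \subset complete_graph n ->
  \sum_(v | (#|component F v| <= M)%N) (#|component F v|%:R : R)^-1 <=
  \sum_(S : {set 'I_n} | (0 < #|S| <= M)%N) (closed_in H F S)%:R.
Proof.
move=> sub.
rewrite (partition_big (component F) (fun S => 0 < #|S| <= M)%N) /=; last first.
  by move=> v ->; rewrite card_component_gt0.
apply: ler_sum => S /andP[S0 SM].
have [cS|ncS] := boolP (closed_in H F S); last first.
  rewrite big1 // => v /andP[_ /eqP e].
  by rewrite -e component_closed_in in ncS.
apply: le_trans (_ : \sum_(v in S) (#|S|%:R : R)^-1 <= _).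
  rewrite big_mkcond [leRHS]big_mkcond /=; apply: ler_sum => v _.
  case: ifPn => [/andP[_ /eqP e]|_]; last by case: ifP.
  have vS : v \in S by rewrite -e component_refl.
  by rewrite vS e.
by rewrite sumr_const -[X in X <= _]mulr_natr mulVf // pnatr_eq0 -lt0n.
Qed.

(** The expected number of nonempty sets of at most M vertices that are left by no present
edge, each edge of H being present with probability q. *)
Definition cutsum H (M : nat) (q : R) : R :=
  \sum_(S : {set 'I_n} | (0 < #|S| <= M)%N) (1 - q) ^+ #|boundary H S|.

Lemma Ex_closed_in H p M :
  Ex H p (fun F => \sum_(S : {set 'I_n} | (0 < #|S| <= M)%N) (closed_in H F S)%:R) = cutsum H M p.
Proof.
rewrite Ex_sum; apply: eq_bigr => S _; rewrite Ex_avoid //.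
by apply/subsetP => e; rewrite inE => /andP[].
Qed.

Lemma inv_component_le F v M : (0 < M)%N -> (#|component F v|%:R : R)^-1 <=
  (if (#|component F v| <= M)%N then (#|component F v|%:R : R)^-1 else 0) + M%:R^-1.
Proof.
move=> M0; case: leqP => [h|h]; first by rewrite lerDl.
by rewrite add0r lef_pV2 ?posrE ?ltr0n // ?card_component_gt0 // ler_nat ltnW.
Qed.

Lemma Ex_kappa_le_cut H p M : H \subset complete_graph n -> 0 <= p <= 1 -> (0 < M)%N ->
  Ex H p (fun F => (kappa F)%:R) <= cutsum H M p + n%:R / M%:R.
Proof.
move=> sub p01 M0; rewrite -Ex_closed_in -[n%:R / _](Ex_const H p) -ExD.
apply: Ex_le => // F _; rewrite kappa_sum.
apply: le_trans (ler_sum _ (fun v _ => inv_component_le F v M0)) _.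
rewrite big_split /= sumr_const card_ord -[_ *+ n]mulr_natl lerD2r -big_mkcond.
exact: small_components_le.
Qed.

(** Two components cannot both have more than n/2 vertices. *)
Lemma big_components_le F :
  \sum_(v | ~~ (#|component F v| <= n./2)%N) (#|component F v|%:R : R)^-1 <= 1.
Proof.
case: (pickP (fun v => ~~ (#|component F v| <= n./2)%N)) => [v0 big0|none]; last first.
  by rewrite big_pred0 // ler01.
apply: le_trans (_ : \sum_(v in component F v0) (#|component F v0|%:R : R)^-1 <= _); last first.
  rewrite sumr_const -[X in X <= _]mulr_natr mulVf // pnatr_eq0 -lt0n.
  exact: card_component_gt0.
rewrite big_mkcond [leRHS]big_mkcond /=; apply: ler_sum => v _.
case: ifPn => [big1|_]; last by case: ifP => // _; rewrite invr_ge0.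
have [e|dis] := component_in F v0 v.
  have vS : v \in component F v0 by rewrite -e component_refl.
  by rewrite vS e.
have : (#|component F v| + #|component F v0| <= n)%N.
  have [_] := leq_card_setU (component F v) (component F v0).
  by rewrite dis => /eqP <-; rewrite -[X in (_ <= X)%N]card_ord max_card.
have hn : (n <= n./2 + n./2 + 1)%N.
  by rewrite -[X in (X <= _)%N]odd_double_half -addnn addnC leq_add2l leq_b1.
move: hn big0 big1; rewrite -!ltnNge; clear.
by move: #|_| #|_| (n./2) => a b c; lia.
Qed.

Lemma Ex_kappa_le_cut_half H p : H \subset complete_graph n -> 0 <= p <= 1 ->
  Ex H p (fun F => (kappa F)%:R) - 1 <= cutsum H n./2 p.
Proof.
move=> sub p01; rewrite -Ex_closed_in lerBlDr -[X in _ + X](Ex_const H p) -ExD.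
apply: Ex_le => // F _; rewrite kappa_sum.
rewrite (bigID (fun v => #|component F v| <= n./2)%N) /=; apply: lerD.
  exact: small_components_le.
exact: big_components_le.
Qed.

Lemma cutsum_mono H M p q : 0 <= p -> p <= q -> q <= 1 -> cutsum H M q <= cutsum H M p.
Proof.
move=> p0 pq q1; apply: ler_sum => S _; rewrite lerXn2r ?nnegrE ?subr_ge0 //.
  exact: le_trans pq q1.
by rewrite lerD2l lerN2.
Qed.

Lemma cutsum_ge0 H M q : q <= 1 -> 0 <= cutsum H M q.
Proof. by move=> q1; apply: sumr_ge0 => S _; rewrite exprn_ge0 // subr_ge0. Qed.

(** A set S of at most M vertices sends at least |S| (r - M) edges outside; the sum over
all S is then a binomial expansion. *)
Lemma cutsum_regular G r M q : (forall v, #|nbrs G v setT| = r) -> 0 <= q <= 1 ->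
  cutsum G M q <= (1 + (1 - q) ^+ (r - M)) ^+ n - 1.
Proof.
move=> reg /andP[q0 q1]; have q0' : 0 <= 1 - q by rewrite subr_ge0.
have q1' : 1 - q <= 1 by rewrite gerBl.
rewrite lerBrDr addrC.
have -> : (1 + (1 - q) ^+ (r - M)) ^+ n =
   \sum_(S : {set 'I_n} | S \subset setT) ((1 - q) ^+ (r - M)) ^+ #|S| * 1 ^+ #|setT :\: S|.
  by rewrite sum_subsets_pow cardsT card_ord addrC.
rewrite (bigD1 set0) ?sub0set //= cards0 expr0 expr1n mulr1 lerD2l.
rewrite /cutsum big_mkcond [leRHS]big_mkcond /=; apply: ler_sum => S _.
rewrite subsetT /= expr1n mulr1 -card_gt0; case: (posnP #|S|) => //= S0.
case: leqP => [SM|_]; last by rewrite !exprn_ge0.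
rewrite -exprM ler_wiXn2l //; apply: leq_trans (card_boundary_regular S reg).
by rewrite mulnC leq_mul2l leq_sub2l ?orbT.
Qed.

(** A disconnected graph has a component with at most n/2 vertices, which is left by no
edge at all; formally this is [Ex_kappa_le_cut_half] at p = 1. *)
Lemma disconnected_cut H : (0 < n)%N -> H \subset complete_graph n -> ~ connected_graph H ->
  forall q, 0 <= q <= 1 -> 1 <= cutsum H n./2 q.
Proof.
move=> n0 sub ncH q /andP[q0 q1].
have k2 : (1 < kappa H)%N by rewrite ltnNge; apply/negP => /connected_kappa.
apply: le_trans (cutsum_mono H n./2 q0 q1 (lexx 1)).
apply: le_trans (Ex_kappa_le_cut_half sub _); last by rewrite ler01 lexx.
rewrite lerBrDr (_ : 1 + 1 = Ex H 1 (fun=> 2%:R)); last by rewrite Ex_const; ring.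
have -> : Ex H 1 (fun F => (kappa F)%:R) = (kappa H)%:R :> R.
  rewrite /Ex (bigD1 H) //= big1 ?addr0.
    by rewrite expr1n setDv cards0 expr0 !mul1r.
  move=> F /andP[FH neF]; rewrite subrr expr0n (_ : _ == _ = false) ?mulr0 ?mul0r //.
  apply/negbTE; rewrite cards_eq0 setD_eq0; apply: contra neF => HF.
  by rewrite eqEsubset FH.
by rewrite Ex_const ler_nat.
Qed.

End Cuts.

(** * The contribution of one component size *)

Section FactorialBounds.
Variable R : realType.

Lemma fact_add_ge b k : (b`! * b ^ k <= (b + k)`!)%N.
Proof.
elim: k => [|k ih]; first by rewrite expn0 muln1 addn0.
rewrite addnS factS expnS mulnCA; apply: leq_mul => //.
by rewrite leqW // leq_addr.
Qed.

Lemma fact_add_le b k : ((b + k)`! <= b`! * (b + k) ^ k)%N.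
Proof.
elim: k => [|k ih]; first by rewrite expn0 muln1 addn0.
rewrite addnS factS expnS mulnCA leq_mul2l; apply/orP; right.
by apply: leq_trans ih _; rewrite leq_mul2l; apply/orP; right; case: k => // k; rewrite leq_exp2r.
Qed.

Lemma bernoulli_ineq (x : R) k : 0 <= x <= 1 -> 1 - k%:R * x <= (1 - x) ^+ k.
Proof.
move=> /andP[x0 x1]; elim: k => [|k ih]; first by rewrite mul0r subr0 expr0.
rewrite exprS; apply: le_trans (_ : (1 - x) * (1 - k%:R * x) <= _); last first.
  by rewrite ler_wpM2l // subr_ge0.
rewrite -natr1 -subr_ge0; have -> : (1 - x) * (1 - k%:R * x) - (1 - (k%:R + 1) * x) = k%:R * (x * x) by ring.
by rewrite mulr_ge0 // mulr_ge0.
Qed.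

(** The Beta integral of p^a (1-p)^b over [0, 1]. *)
Definition beta_value (a b : nat) : R := (a`! * b`!)%:R / (a + b).+1`!%:R.

(** The index k is the component size minus one.  With K = k + 1 the term is at most (n/r)
K^(-3) (1 - 2K/r)^(-K), and Bernoulli's inequality bounds the last factor by 1 + 4 K^2/r
because 2 K^2/r <= 1/2. *)
Lemma upper_term (n r k L : nat) : (0 < r)%N -> (4 * L ^ 2 <= r)%N -> (k < L)%N ->
  n%:R / k.+1%:R * ((k.+1%:R * r%:R) ^+ k / k.+1`!%:R) * beta_value k (k.+1 * (r - 2 * k.+1))
  <= n%:R / r%:R * (k.+1%:R ^- 3 + 4 / r%:R) :> R.
Proof.
move=> r0 Lr kL; set K := k.+1; set s := (r - 2 * K)%N; set b := (K * s)%N.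
have K2 : (4 * K ^ 2 <= r)%N.
  by apply: leq_trans Lr; rewrite leq_mul2l /= leq_exp2r.
have K0 : (0 : R) < K%:R by rewrite ltr0n.
have r0' : (0 : R) < r%:R by rewrite ltr0n.
have K1 : (1 : R) <= K%:R by rewrite ler1n.
have KK : (2 * K <= r)%N by move: K2; rewrite /K; clear; move: k => k; nia.
have sE : (s%:R : R) = r%:R - 2 * K%:R by rewrite /s natrB // natrM.
have rK2 : (4 : R) * K%:R ^+ 2 <= r%:R by rewrite -natrX -natrM ler_nat.
have s0 : (0 : R) < s%:R by rewrite sE; nra.
have b0 : (0 : R) < b%:R by rewrite natrM mulr_gt0.
have beta_le : beta_value k b <= k`!%:R / b%:R ^+ K.
  rewrite /beta_value natrM ler_pdivrMr ?ltr0n ?fact_gt0 // mulrAC -mulrA ler_wpM2l //.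
  rewrite ler_pdivlMr ?exprn_gt0 // -natrX -natrM ler_nat -addSn addnC.
  exact: fact_add_ge.
apply: le_trans (_ : n%:R / K%:R * ((K%:R * r%:R) ^+ k / K`!%:R) * (k`!%:R / b%:R ^+ K) <= _).
  by rewrite ler_wpM2l // !(mulr_ge0, divr_ge0, exprn_ge0, invr_ge0).
have -> : n%:R / K%:R * ((K%:R * r%:R) ^+ k / K`!%:R) * (k`!%:R / b%:R ^+ K) =
   n%:R / r%:R * (K%:R ^- 3 * (s%:R / r%:R) ^- K) :> R.
  rewrite /K factS -/K natrM /b natrM !exprMn exprVn !exprS -/K expr0 !invfM invrK.
  have := fact_neq0 R k; have := lt0r_neq0 K0; have := lt0r_neq0 s0; have := lt0r_neq0 r0'.
  by move=> h1 h2 h3 h4; field; rewrite ?h1 ?h2 ?h3 ?h4 ?expf_neq0.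
rewrite ler_wpM2l ?divr_ge0 //.
set u := K%:R * (2 * K%:R / r%:R) : R.
have u0 : 0 <= u by rewrite !(mulr_ge0, divr_ge0, invr_ge0).
have uE : u = 2 * K%:R ^+ 2 / r%:R by rewrite /u; field; exact: lt0r_neq0.
have u2 : u <= 1 / 2 by rewrite uE ler_pdivrMr //; nra.
have sr : s%:R / r%:R = 1 - 2 * K%:R / r%:R :> R.
  by rewrite sE; field; exact: lt0r_neq0.
have bern : 1 - u <= (s%:R / r%:R) ^+ K.
  rewrite sr; apply: bernoulli_ineq; apply/andP; split; first by rewrite !(mulr_ge0, divr_ge0, invr_ge0).
  by rewrite ler_pdivrMr //; nra.
have inv_le : (s%:R / r%:R) ^- K <= 1 + 2 * u.
  apply: le_trans (_ : (1 - u)^-1 <= _); first by rewrite lef_pV2 // posrE ?exprn_gt0 ?divr_gt0 //; lra.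
  by rewrite -[X in X <= _]mul1r ler_pdivrMr; nra.
apply: le_trans (ler_wpM2l _ inv_le) _; first by rewrite invr_ge0 exprn_ge0.
rewrite mulrDr mulr1 lerD2l uE.
have -> : K%:R ^- 3 * (2 * (2 * K%:R ^+ 2 / r%:R)) = (4 / r%:R) / K%:R :> R.
  by field; rewrite !lt0r_neq0.
by rewrite ler_pdivrMr // ler_peMr // divr_ge0.
Qed.

(** The factor 1 - p/x, here in integrated form, is a lower bound for the indicator of p <
x which stays a polynomial; it costs only the relative error 1/(r x). *)
Lemma lower_term (n r k L : nat) (x : R) : (0 < r)%N -> (4 * L ^ 2 <= r)%N -> (k < L)%N ->
  0 < x -> 1 <= r%:R * x ->
  n%:R / r.+1%:R * (1 - (r%:R * x)^-1) * (k.+1%:R ^- 3 - 2 / r%:R) <=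
  n%:R / k.+1%:R * ((k.+1%:R * (r - 2 * k.+1)%:R) ^+ k / k.+1`!%:R) *
   (beta_value k (k.+1 * r) - beta_value k.+1 (k.+1 * r) / x) :> R.
Proof.
move=> r0 Lr kL x0 rx; set K := k.+1; set s := (r - 2 * K)%N; set b := (K * r)%N.
have K2 : (4 * K ^ 2 <= r)%N.
  by apply: leq_trans Lr; rewrite leq_mul2l /= leq_exp2r.
have K0 : (0 : R) < K%:R by rewrite ltr0n.
have r0' : (0 : R) < r%:R by rewrite ltr0n.
have r10 : (0 : R) < r.+1%:R by rewrite ltr0n.
have K1 : (1 : R) <= K%:R by rewrite ler1n.
have KK : (2 * K <= r)%N by move: K2; rewrite /K; clear; move: k => k; nia.
have sE : (s%:R : R) = r%:R - 2 * K%:R by rewrite /s natrB // natrM.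
have rK2 : (4 : R) * K%:R ^+ 2 <= r%:R by rewrite -natrX -natrM ler_nat.
have s0 : (0 : R) < s%:R by rewrite sE; nra.
have b0 : (0 : R) < b%:R by rewrite natrM mulr_gt0.
have B0 : 0 <= beta_value k b by rewrite divr_ge0.
(* Raising the first exponent by one multiplies the Beta value by K / (b + K + 1), which is at most 1 / r because b = K r. *)
have beta2 : beta_value K b <= beta_value k b / r%:R.
  have -> : beta_value K b = beta_value k b * (K%:R / (k + b).+2%:R).
    rewrite /beta_value /K addSn; move: (k + b)%N.+1 => m.
    rewrite (factS m) (factS k) !natrM.
    have h1 := fact_neq0 R m; have h2 : (m.+1%:R : R) != 0 by rewrite pnatr_eq0.
    by move: (m`!%:R : R) (m.+1%:R : R) h1 h2 => y z h1 h2; field; rewrite h1 h2.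
  rewrite ler_wpM2l // ler_pdivrMr ?ltr0n // mulrC ler_pdivlMr // -natrM ler_nat.
  by apply: leq_trans (leq_trans (leq_addl k b) (leqW (leqW (leqnn _)))); rewrite /b mulnC.
have beta_ge : k`!%:R / (K%:R * r.+1%:R) ^+ K <= beta_value k b.
  rewrite /beta_value natrM ler_pdivlMr ?ltr0n ?fact_gt0 // mulrAC -mulrA ler_wpM2l //.
  rewrite ler_pdivrMr ?exprn_gt0 ?mulr_gt0 // -natrM -natrX -natrM ler_nat.
  have -> : (K * r.+1 = b + K)%N by rewrite mulnS addnC.
  by rewrite -addSn addnC fact_add_le.
set q := 1 - (r%:R * x)^-1.
have q0 : 0 <= q by rewrite subr_ge0 invf_le1 // mulr_gt0.
have brack : k`!%:R / (K%:R * r.+1%:R) ^+ K * q <= beta_value k b - beta_value K b / x.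
  apply: le_trans (_ : beta_value k b * q <= _); first by rewrite ler_wpM2r.
  rewrite mulrBr mulr1 lerD2l lerN2 invfM mulrA ler_wpM2r // invr_ge0 ltW //.
apply: le_trans (_ : n%:R / K%:R * ((K%:R * s%:R) ^+ k / K`!%:R) *
    (k`!%:R / (K%:R * r.+1%:R) ^+ K * q) <= _); last first.
  by rewrite ler_wpM2l // !(mulr_ge0, divr_ge0, exprn_ge0, invr_ge0).
have -> : n%:R / K%:R * ((K%:R * s%:R) ^+ k / K`!%:R) * (k`!%:R / (K%:R * r.+1%:R) ^+ K * q) =
   n%:R / r.+1%:R * q * (K%:R ^- 3 * (s%:R / r.+1%:R) ^+ k) :> R.
  rewrite /K factS -/K natrM !exprMn exprVn !exprS -/K expr0 !invfM.
  have := fact_neq0 R k; have := lt0r_neq0 K0; have := lt0r_neq0 r10.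
  by move=> h1 h2 h3; field; rewrite nat1r h1 h2 h3 !expf_neq0.
rewrite ler_wpM2l ?mulr_ge0 ?invr_ge0 //.
set v := (2 * K%:R + 1) / r.+1%:R : R.
have r1E : (r.+1%:R : R) = r%:R + 1 by rewrite -natr1.
have sr : s%:R / r.+1%:R = 1 - v :> R.
  by rewrite /v sE r1E; field; rewrite -r1E lt0r_neq0.
have bern : 1 - k%:R * v <= (s%:R / r.+1%:R) ^+ k.
  rewrite sr; apply: bernoulli_ineq; apply/andP; split; first by rewrite !(mulr_ge0, divr_ge0, invr_ge0, addr_ge0).
  by rewrite ler_pdivrMr // r1E; nra.
apply: le_trans (ler_wpM2l _ bern); last by rewrite invr_ge0 exprn_ge0.
rewrite mulrBr mulr1 lerD2l lerN2.
have kE : (k%:R : R) = K%:R - 1 by rewrite /K -natr1 addrK.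
have kv : k%:R * v <= 2 * K%:R ^+ 2 / r%:R.
  rewrite /v mulrA ler_pdivrMr // mulrAC ler_pdivlMr // kE r1E; nra.
apply: le_trans (ler_wpM2l _ kv) _; first by rewrite invr_ge0 exprn_ge0.
have -> : K%:R ^- 3 * (2 * K%:R ^+ 2 / r%:R) = (2 / r%:R) / K%:R :> R.
  by field; rewrite !lt0r_neq0.
by rewrite ler_pdivrMr // ler_peMr // divr_ge0.
Qed.

End FactorialBounds.

(** * Integration over the unit interval and bounds for kappa *)

Section Integral01.
Local Open Scope classical_set_scope.
Local Open Scope ring_scope.
Variable R : realType.
Local Notation mu := (@lebesgue_measure R).
Implicit Types f g : R -> R.

(** Integrability and the value of the integral are carried together, so that the integral
of a composite expression is read off from its syntax. *)
Definition has_int01 f (v : R) : Prop :=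
  mu.-integrable `[0, 1] (EFin \o f) /\ \int[mu]_(p in `[0, 1]) f p = v.

Lemma eq_has_int01 f g a b : has_int01 f a -> f =1 g -> a = b -> has_int01 g b.
Proof. by move=> h /funext <- <-. Qed.

Lemma has_int01D f g a b : has_int01 f a -> has_int01 g b ->
  has_int01 (fun p => f p + g p) (a + b).
Proof.
move=> [if_ <-] [ig <-]; split; last by rewrite RintegralD.
by apply: (@integrableD _ _ _ mu _ _ (EFin \o f) (EFin \o g)).
Qed.

Lemma has_int01Z f a c : has_int01 f a -> has_int01 (fun p => c * f p) (c * a).
Proof.
move=> [if_ <-]; split; last by rewrite RintegralZl.
by apply: (@integrableZl _ _ _ mu _ _ c (EFin \o f)).
Qed.

Lemma has_int01_continuous f : continuous f ->
  has_int01 f (\int[mu]_(p in `[0, 1]) f p).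
Proof. by move=> cf; split => //; exact: continuous_integrable01. Qed.

Lemma has_int01_cst c : has_int01 (fun=> c) c.
Proof.
split; first by apply: continuous_integrable01 => x; exact: cvg_cst.
rewrite Rintegral_cst //=.
by rewrite lebesgue_measure_itv /= lte01 EFinN sube0 mulr1.
Qed.

Lemma has_int01_sum (I : Type) (s : seq I) (f : I -> R -> R) (v : I -> R) :
  (forall i, has_int01 (f i) (v i)) ->
  has_int01 (fun p => \sum_(i <- s) f i p) (\sum_(i <- s) v i).
Proof.
move=> h; elim: s => [|i s ih].
  rewrite big_nil (_ : (fun _ => _) = fun=> 0); first exact: has_int01_cst.
  by apply/funext => p; rewrite big_nil.
rewrite big_cons (_ : (fun _ => _) = fun p => f i p + \sum_(j <- s) f j p).
  exact: has_int01D.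
by apply/funext => p; rewrite big_cons.
Qed.

Lemma has_int01_beta a b : has_int01 (fun p => p ^+ a * (1 - p) ^+ b) (beta_value R a b).
Proof.
split; first exact: integrable_XMonemX.
by rewrite /beta_value -beta_fun_fact /beta_fun -Rintegral_mkcond.
Qed.

Lemma has_int01_lt w : 0 <= w <= 1 -> has_int01 (fun p => ((p < w)%R%:R : R)) w.
Proof.
move=> w01; have i := integral_indic_lt w01.
apply: (@eq_has_int01 (\1_[set` `]-oo, w[ ]) _ w) => //; last first.
  by move=> p; rewrite indicE mem_setE in_itv.
split; last by rewrite /Rintegral i.
apply/integrableP; split.
  by apply/measurable_EFinP; apply: measurable_indic; exact: measurable_itv.
by under eq_integral do rewrite /= ger0_norm //; rewrite i ltry.
Qed.

Lemma has_int01_le f g a b : has_int01 f a -> has_int01 g b ->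
  (forall p, 0 <= p <= 1 -> f p <= g p) -> a <= b.
Proof.
move=> [if_ <-] [ig <-] fg; apply: le_Rintegral => //.
Qed.

End Integral01.

Section KappaBounds.
Import mathcomp.boot.fintype mathcomp.boot.finset.
Local Open Scope set_scope.
Variables (R : realType) (n r : nat) (G A : {set {set 'I_n}}).
Hypothesis reg : forall v, #|nbrs G v [set: 'I_n]%SET| = r.
Hypothesis dGA : [disjoint G & A].
Hypothesis subG : G \subset complete_graph n.
Hypothesis subA : A \subset complete_graph n.
Local Notation H := (G :|: A)%SET.
Implicit Types (p : R) (F : {set {set 'I_n}}).

Lemma Ex_kappa_union_le p : 0 <= p <= 1 ->
  Ex H p (fun F => (kappa F)%:R) <= Ex G p (fun F => (kappa F)%:R).
Proof.
move=> p01; rewrite Ex_split //; apply: Ex_le => // F1 _.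
rewrite -[leRHS](Ex_const A p); apply: Ex_le => // F2 _.
by rewrite ler_nat kappa_mono // subsetUl.
Qed.

(** Each present edge of A merges at most two components, and p |A| such edges are present
on average. *)
Lemma Ex_kappa_union_ge p : 0 <= p <= 1 ->
  Ex G p (fun F => (kappa F)%:R) - p * #|A|%:R <= Ex H p (fun F => (kappa F)%:R).
Proof.
move=> p01; rewrite Ex_split // -Ex_card -(Ex_const G p (Ex A p _)) -ExB.
apply: Ex_le => // F1 _; rewrite -[X in X - _](Ex_const A p) -ExB.
apply: Ex_le => // F2 F2A; rewrite lerBlDr -natrD ler_nat.
by apply: kappa_union_le; exact: subset_trans F2A subA.
Qed.

Lemma inverse_by_cases (c L : nat) : (0 < c)%N ->
  \sum_(k < L) (k.+1%:R : R)^-1 * (c == k.+1)%:R = if (c <= L)%N then (c%:R : R)^-1 else 0.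
Proof.
case: c => // c _; case: ifPn => cL.
  rewrite (bigD1 (Ordinal cL)) //= big1 ?addr0 ?eqxx ?mulr1 // => k.
  by rewrite -val_eqE /= eqSS eq_sym => /negbTE ->; rewrite mulr0.
apply: big1 => k _; rewrite (_ : _ == _ = false) ?mulr0 //.
by apply/negbTE; apply: contra cL => /eqP ->.
Qed.

(** Components with more than L vertices number at most n/L. *)
Lemma kappa_by_size F L : (0 < L)%N ->
  \sum_(k < L) (k.+1%:R : R)^-1 * (\sum_v (#|component F v| == k.+1)%:R) <= (kappa F)%:R
  <= \sum_(k < L) (k.+1%:R : R)^-1 * (\sum_v (#|component F v| == k.+1)%:R) + n%:R / L%:R.
Proof.
move=> L0.
have -> : \sum_(k < L) (k.+1%:R : R)^-1 * (\sum_v (#|component F v| == k.+1)%:R) =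
    \sum_v (if (#|component F v| <= L)%N then (#|component F v|%:R : R)^-1 else 0).
  under eq_bigr do rewrite mulr_sumr.
  rewrite exchange_big /=; apply: eq_bigr => v _.
  by rewrite inverse_by_cases // card_component_gt0.
rewrite kappa_sum; apply/andP; split.
  by apply: ler_sum => v _; case: ifP.
have -> : n%:R / L%:R = \sum_(v : 'I_n) (L%:R : R)^-1.
  by rewrite sumr_const card_ord -[RHS]mulr_natl.
by rewrite -big_split /=; apply: ler_sum => v _; exact: inv_component_le.
Qed.

(** The bounds of [component_size_bounds] for the sizes k + 1, each multiplied by n / (k +
1) because a component of that size is seen from k + 1 vertices. *)
Definition upper_poly L p : R := \sum_(k < L)
  n%:R / k.+1%:R * ((k.+1%:R * r%:R) ^+ k / k.+1`!%:R) *
  (p ^+ k * (1 - p) ^+ (k.+1 * (r - 2 * k.+1))).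

Definition lower_poly L p : R := \sum_(k < L)
  n%:R / k.+1%:R * ((k.+1%:R * (r - 2 * k.+1)%:R) ^+ k / k.+1`!%:R) *
  (p ^+ k * (1 - p) ^+ (k.+1 * r)).

Lemma Ex_kappa_bounds p L : 0 <= p <= 1 -> (0 < L)%N -> (2 * L <= r)%N ->
  lower_poly L p <= Ex G p (fun F => (kappa F)%:R) <= upper_poly L p + n%:R / L%:R.
Proof.
move=> p01 L0 Lr.
set T := \sum_(k < L) (k.+1%:R : R)^-1 * \sum_(v : 'I_n) Ex G p (fun F => (#|component F v| == k.+1)%:R).
have TE : Ex G p (fun F => \sum_(k < L) (k.+1%:R : R)^-1 * (\sum_v (#|component F v| == k.+1)%:R)) = T.
  by rewrite Ex_sum; apply: eq_bigr => k _; rewrite ExZ Ex_sum.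
have nsum (c : R) : \sum_(v : 'I_n) c = n%:R * c by rewrite sumr_const card_ord mulr_natl.
apply/andP; split.
  apply: le_trans (_ : T <= _).
    apply: ler_sum => k _; set c := (k.+1%:R * (r - 2 * k.+1)%:R) ^+ k / k.+1`!%:R.
    rewrite (_ : _ * _ = k.+1%:R^-1 * \sum_(v : 'I_n) (c * (p ^+ k * (1 - p) ^+ (k.+1 * r)))).
      rewrite ler_wpM2l ?invr_ge0 //; apply: ler_sum => v _.
      have kr : (2 * k.+1 <= r)%N by apply: leq_trans Lr; rewrite leq_mul2l /=.
      have /andP[le _] := component_size_bounds reg v p01 (ltn0Sn k) kr.
      apply: le_trans le; rewrite /c /= !exprMn le_eqVlt; apply/orP; left; apply/eqP; ring.
    by rewrite nsum; ring.
  rewrite -TE; apply: Ex_le => // F _; by have /andP[] := kappa_by_size F L0.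
apply: le_trans (_ : T + n%:R / L%:R <= _).
  rewrite -TE -[n%:R / _](Ex_const G p) -ExD; apply: Ex_le => // F _.
  by have /andP[] := kappa_by_size F L0.
rewrite lerD2r; apply: ler_sum => k _; set c := (k.+1%:R * r%:R) ^+ k / k.+1`!%:R.
rewrite [leRHS](_ : _ = k.+1%:R^-1 * \sum_(v : 'I_n) (c * (p ^+ k * (1 - p) ^+ (k.+1 * (r - 2 * k.+1))))).
  rewrite ler_wpM2l ?invr_ge0 //; apply: ler_sum => v _.
  have kr : (2 * k.+1 <= r)%N by apply: leq_trans Lr; rewrite leq_mul2l /=.
  have /andP[_ le] := component_size_bounds reg v p01 (ltn0Sn k) kr.
  apply: le_trans le _; rewrite /c /= !exprMn le_eqVlt; apply/orP; left; apply/eqP; ring.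
by rewrite nsum; ring.
Qed.

End KappaBounds.

(** * Two-sided bounds for mst *)

Section MstBounds.
Import mathcomp.boot.fintype mathcomp.boot.finset.
Local Open Scope set_scope.
Variables (R : realType) (n r : nat) (d : measure_display) (Omega : measurableType d).
Variables (P : probability Omega R) (W : {set 'I_n} -> {RV P >-> R}).
Variables (G A : {set {set 'I_n}}).
Hypothesis n0 : (0 < n)%N.
Hypothesis iidW : iid_uniform_weights W.
Hypothesis reg : forall v, #|nbrs G v [set: 'I_n]%SET| = r.
Hypothesis dGA : [disjoint G & A].
Hypothesis subG : G \subset complete_graph n.
Hypothesis subA : A \subset complete_graph n.
Local Notation H := (G :|: A)%SET.
Hypothesis cH : connected_graph H.

Definition zeta_part (L : nat) : R := \sum_(k < L) (k.+1%:R : R) ^- 3.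

Let g (p : R) : R := Ex H p (fun F => (kappa F)%:R) - 1.

Let subH : H \subset complete_graph n.
Proof. by rewrite subUset subG. Qed.

Let g_int : has_int01 g (mst W H).
Proof.
rewrite (mst_integral n0 iidW subH cH); apply: has_int01_continuous => p.
by apply: cvgB; [exact: Ex_continuous|exact: cvg_cst].
Qed.

Let g_ge0 p : 0 <= p <= 1 -> 0 <= g p.
Proof.
move=> p01; rewrite subr_ge0 -[leLHS](Ex_const H p); apply: Ex_le => // F _.
by rewrite ler1n kappa_gt0.
Qed.

Let upper_poly_ge0 L (p : R) : 0 <= p <= 1 -> 0 <= upper_poly n r L p.
Proof.
move=> /andP[p0 p1]; apply: sumr_ge0 => k _.
have q0 : 0 <= 1 - p by rewrite subr_ge0.
by rewrite !(mulr_ge0, divr_ge0, exprn_ge0, invr_ge0).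
Qed.

Let lower_poly_ge0 L (p : R) : 0 <= p <= 1 -> 0 <= lower_poly n r L p.
Proof.
move=> /andP[p0 p1]; apply: sumr_ge0 => k _.
have q0 : 0 <= 1 - p by rewrite subr_ge0.
by rewrite !(mulr_ge0, divr_ge0, exprn_ge0, invr_ge0).
Qed.

(** The integrand is bounded differently on p < d1, on d1 <= p < d2 and on p >= d2: by the
small components plus n/L, by the union bound over sets of at most M vertices plus n/M,
and by the cuts of H. *)
Lemma mst_upper L M (d1 d2 : R) : (0 < r)%N -> (0 < L)%N -> (4 * L ^ 2 <= r)%N -> (0 < M)%N ->
  0 <= d1 -> d1 <= d2 -> d2 <= 1 ->
  mst W H <= n%:R / r%:R * (zeta_part L + 4 * L%:R / r%:R) + n%:R / L%:R * d1
    + (cutsum G M d1 + n%:R / M%:R) * d2 + cutsum H n./2 d2.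
Proof.
move=> r0 L0 Lr M0 d10 d12 d21.
have Lr2 : (2 * L <= r)%N by apply: leq_trans Lr; clear -L0; nia.
have d1_1 : d1 <= 1 by exact: le_trans d21.
have d20 : 0 <= d2 by exact: le_trans d12.
have c10 := cutsum_ge0 G M d1_1; have c20 := cutsum_ge0 H n./2 d21.
have up_int : has_int01 (upper_poly n r L) (\sum_(k < L)
    n%:R / k.+1%:R * ((k.+1%:R * r%:R) ^+ k / k.+1`!%:R) * beta_value R k (k.+1 * (r - 2 * k.+1))).
  by apply: has_int01_sum => k; apply: has_int01Z; exact: has_int01_beta.
have i1 : has_int01 (fun p => n%:R / L%:R * (p < d1)%R%:R : R) (n%:R / L%:R * d1).
  by apply: has_int01Z; apply: has_int01_lt; rewrite d10.
have i2 : has_int01 (fun p => (cutsum G M d1 + n%:R / M%:R) * (p < d2)%R%:R : R)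
    ((cutsum G M d1 + n%:R / M%:R) * d2).
  by apply: has_int01Z; apply: has_int01_lt; rewrite d20.
have tot := has_int01D (has_int01D (has_int01D up_int i1) i2) (has_int01_cst (cutsum H n./2 d2)).
apply: le_trans (has_int01_le g_int tot _) _; last first.
  do 3 apply: lerD => //.
  rewrite (_ : _ * (_ + _) = \sum_(k < L) n%:R / r%:R * (k.+1%:R ^- 3 + 4 / r%:R)); last first.
    rewrite -mulr_sumr big_split /= sumr_const card_ord -[_ *+ L]mulr_natl.
    by congr (_ * (_ + _)); ring.
  by apply: ler_sum => k _; apply: upper_term Lr _.
move=> p p01; have up0 := upper_poly_ge0 L p01.
have nL : (0 : R) <= n%:R / L%:R by rewrite divr_ge0.
have nM : (0 : R) <= n%:R / M%:R by rewrite divr_ge0.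
have gG : g p <= Ex G p (fun F => (kappa F)%:R).
  rewrite lerBlDr; apply: le_trans (Ex_kappa_union_le dGA p01) _.
  by rewrite lerDl.
have /andP[p0 p1] := p01.
case: (ltP p d2) => pd2; last first.
  have h : g p <= cutsum H n./2 d2.
    apply: le_trans (Ex_kappa_le_cut_half subH p01) _.
    exact: cutsum_mono.
  have m1 : 0 <= n%:R / L%:R * (p < d1)%R%:R :> R by rewrite mulr_ge0.
  by rewrite mulr0 addr0; apply: le_trans h _; rewrite lerDr addr_ge0.
rewrite mulr1; case: (ltP p d1) => pd1.
  have /andP[_ h] := Ex_kappa_bounds reg p01 L0 Lr2.
  rewrite mulr1; apply: le_trans (le_trans gG h) _; rewrite -addrA lerDl.
  by rewrite !addr_ge0.
have h := Ex_kappa_le_cut subG p01 M0.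
have cm := cutsum_mono G M d10 pd1 p1.
rewrite mulr0 addr0; apply: le_trans (le_trans gG h) _.
rewrite -[leLHS]add0r -[leLHS]addr0; apply: lerD => //; apply: lerD => //.
by rewrite lerD2r.
Qed.

(** Below x the added edges remove at most |A| x components on average and the integrand
is at least the small component count; above x the integrand is nonnegative while 1 - p/x
is not positive. *)
Lemma mst_lower L (x : R) : (0 < r)%N -> (0 < L)%N -> (4 * L ^ 2 <= r)%N ->
  0 < x -> x <= 1 -> 1 <= r%:R * x ->
  n%:R / r.+1%:R * (1 - (r%:R * x)^-1) * (zeta_part L - 2 * L%:R / r%:R)
   - (1 + #|A|%:R * x) * x <= mst W H.
Proof.
move=> r0 L0 Lr x0 x1 rx.
have Lr2 : (2 * L <= r)%N by apply: leq_trans Lr; clear -L0; nia.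
pose c k : R := n%:R / k.+1%:R * ((k.+1%:R * (r - 2 * k.+1)%:R) ^+ k / k.+1`!%:R).
have lo_int : has_int01 (fun p => \sum_(k < L) c k * (p ^+ k * (1 - p) ^+ (k.+1 * r) +
      - x^-1 * (p ^+ k.+1 * (1 - p) ^+ (k.+1 * r))))
    (\sum_(k < L) c k * (beta_value R k (k.+1 * r) + - x^-1 * beta_value R k.+1 (k.+1 * r))).
  apply: has_int01_sum => k; apply: has_int01Z; apply: has_int01D.
    exact: has_int01_beta.
  by apply: has_int01Z; exact: has_int01_beta.
have i1 : has_int01 (fun p => - (1 + #|A|%:R * x) * (p < x)%R%:R : R) (- (1 + #|A|%:R * x) * x).
  by apply: has_int01Z; apply: has_int01_lt; rewrite ltW.
have tot := has_int01D lo_int i1.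
apply: le_trans (has_int01_le tot g_int _).
  rewrite mulNr lerD2r.
  rewrite (_ : _ * (_ - _ / _) = \sum_(k < L) n%:R / r.+1%:R * (1 - (r%:R * x)^-1) * (k.+1%:R ^- 3 - 2 / r%:R)); last first.
    rewrite -mulr_sumr sumrB sumr_const card_ord -[_ *+ L]mulr_natl.
    by congr (_ * (_ - _)); ring.
  apply: ler_sum => k _; apply: le_trans (lower_term n r0 Lr (ltn_ord k) x0 rx) _.
  by rewrite mulNr [x^-1 * _]mulrC.
move=> p p01; have lo0 := lower_poly_ge0 L p01; have /andP[p0 p1] := p01.
rewrite (_ : \sum_(k < L) _ = lower_poly n r L p * (1 - p / x)); last first.
  by rewrite /lower_poly mulr_suml; apply: eq_bigr => k _; rewrite /c exprS; ring.
have A0 : (0 : R) <= #|A|%:R by [].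
case: (ltP p x) => px; last first.
  rewrite mulr0 addr0; apply: le_trans (g_ge0 p01).
  by rewrite mulr_ge0_le0 // subr_le0 ler_pdivlMr // mul1r.
rewrite mulr1 /g; have := Ex_kappa_union_ge dGA subA p01.
have /andP[lo _] := Ex_kappa_bounds reg p01 L0 Lr2.
have lo1 : lower_poly n r L p * (1 - p / x) <= lower_poly n r L p.
  by rewrite ler_piMr // gerBl divr_ge0 // ltW.
have pA : p * #|A|%:R <= #|A|%:R * x by rewrite mulrC ler_wpM2l // ltW.
lra.
Qed.

End MstBounds.

(** * Cuts after adding random edges *)

Section Thinning.
Import mathcomp.boot.fintype mathcomp.boot.finset.
Local Open Scope set_scope.

(** The probability that a random m-subset of an N-set avoids j given elements is at most
(1 - m/N)^j. *)
Lemma bin_sub_le N m j : (m <= N)%N -> (j <= N)%N ->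
  ('C(N - j, m) * N ^ j <= 'C(N, m) * (N - m) ^ j)%N.
Proof.
move=> mN; elim: j => [|j ih] jN; first by rewrite subn0 !expn0.
rewrite !expnS.
have := ih (ltnW jN); set n := (N - j)%N => h.
have n0 : (0 < n)%N by rewrite subn_gt0.
rewrite subnS -/n; rewrite -(leq_pmul2l n0).
rewrite mulnA mul_bin_down.
apply: leq_trans (_ : (N - m) * (n * ('C(n, m) * N ^ j)) <= _)%N.
  have -> : ((n - m) * 'C(n, m) * (N * N ^ j) = ((n - m) * N) * ('C(n, m) * N ^ j))%N.
    by rewrite -!mulnA; congr muln; rewrite mulnCA.
  rewrite [X in (_ <= X)%N]mulnA leq_mul2r; apply/orP; right.
  by rewrite /n; clear -mN jN; nia.
rewrite mulnCA leq_mul2l; apply/orP; right.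
by rewrite [X in (_ <= X)%N]mulnCA leq_mul2l h orbT.
Qed.

Variables (R : realType) (I : finType) (N : {set I}).
Implicit Types (q : R) (A D : {set I}).

Lemma avg_avoid m (D' : {set I}) : (m <= #|N|)%N -> D' \subset N ->
  \sum_(A : {set I} | (A \subset N) && (#|A| == m)) ((D' :&: A == set0)%:R : R) <=
  'C(#|N|, m)%:R * (1 - m%:R / #|N|%:R) ^+ #|D'|.
Proof.
move=> mN DN.
have -> : \sum_(A : {set I} | (A \subset N) && (#|A| == m)) ((D' :&: A == set0)%:R : R) =
   'C(#|N| - #|D'|, m)%:R.
  rewrite -[(#|N| - #|D'|)%N](_ : #|N :\: D'| = _); last by rewrite cardsD (setIidPr DN).
  rewrite -cards_draws -sum1_card natr_sum big_mkcond [RHS]big_mkcond /=.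
  apply: eq_bigr => A _; rewrite inE subsetD disjoint_sym -setI_eq0.
  by case: (A \subset N) => //=; case: (#|A| == m); case: (_ == set0).
have DNc := subset_leq_card DN.
have [N0|N0] := posnP #|N|.
  have -> : #|D'| = 0%N by apply/eqP; rewrite -leqn0 -N0.
  by rewrite subn0 expr0 mulr1.
have N0' : (0 : R) < #|N|%:R by rewrite ltr0n.
have -> : 1 - m%:R / #|N|%:R = (#|N| - m)%:R / #|N|%:R :> R.
  by rewrite natrB //; field; exact: lt0r_neq0.
rewrite expr_div_n mulrA ler_pdivlMr ?exprn_gt0 // -!natrX -!natrM ler_nat.
exact: bin_sub_le.
Qed.

(** Read (1 - q)^|A cap D| as the probability that A avoids a q-random subset of D.  After
exchanging the two averages the random set A has to avoid a fixed set, which is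
[avg_avoid]. *)
Lemma avg_thinning m q D : (m <= #|N|)%N -> D \subset N -> 0 <= q <= 1 ->
  \sum_(A : {set I} | (A \subset N) && (#|A| == m)) (1 - q) ^+ #|A :&: D| <=
  'C(#|N|, m)%:R * (1 - q * (m%:R / #|N|%:R)) ^+ #|D|.
Proof.
move=> mN DN q01.
rewrite (eq_bigr (fun A => Ex D q (fun F => (F :&: (A :&: D) == set0)%:R))); last first.
  by move=> A _; rewrite Ex_avoid // subsetIr.
rewrite -Ex_sum.
apply: le_trans (_ : Ex D q (fun F => 'C(#|N|, m)%:R * (1 - m%:R / #|N|%:R) ^+ #|F|) <= _).
  apply: Ex_le => // F FD.
  apply: le_trans (avg_avoid mN (subset_trans FD DN)).
  apply: ler_sum => A _; by rewrite setIA setIAC (setIidPl FD).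
rewrite ExZ ler_wpM2l // /Ex.
rewrite (eq_bigr (fun F : {set I} => (q * (1 - m%:R / #|N|%:R)) ^+ #|F| * (1 - q) ^+ #|D :\: F|)).
  by rewrite sum_subsets_pow le_eqVlt; apply/orP; left; apply/eqP; congr (_ ^+ _); ring.
by move=> F _; rewrite exprMn; ring.
Qed.

End Thinning.

Section RandomCut.
Import mathcomp.boot.fintype mathcomp.boot.finset.
Local Open Scope set_scope.
Variables (R : realType) (n : nat) (G : {set {set 'I_n}}).
Hypothesis subG : G \subset complete_graph n.
Local Notation N := (complete_graph n :\: G).
Implicit Types (q : R) (A D : {set {set 'I_n}}).

Lemma mem_edge_additions m A :
  (A \in edge_additions G m) = (A \subset N) && (#|A| == m).
Proof. by rewrite inE. Qed.

Lemma card_edge_additions m : #|edge_additions G m| = 'C(#|N|, m).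
Proof. by rewrite -cards_draws. Qed.

Lemma card_boundary_union A (S : {set 'I_n}) : A \subset N ->
  #|boundary (G :|: A) S| = (#|boundary G S| + #|A :&: boundary N S|)%N.
Proof.
move=> AN; rewrite -[RHS]subn0 -(cards0 {set 'I_n}).
rewrite -(_ : boundary G S :&: (A :&: boundary N S) = set0); last first.
  apply/setP => e; rewrite !inE; case: (e \in G) => //=.
  by rewrite !andbF.
rewrite -cardsU; apply: eq_card => e; rewrite !inE.
have := subsetP AN e; rewrite !inE.
case: (e \in A) => [/(_ isT)/andP[/negbTE -> ->]|_] /=; first by [].
by rewrite !orbF.
Qed.

Lemma card_boundary_split (S : {set 'I_n}) :
  #|boundary (complete_graph n) S| = (#|boundary G S| + #|boundary N S|)%N.
Proof.
have {1}-> : complete_graph n = G :|: N.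
  by rewrite setDE setUIr setUCr setIT (setUidPr subG).
rewrite card_boundary_union ?subxx //; congr (_ + #|pred_of_set _|)%N.
by apply/setIidPr/subsetP => e; rewrite inE => /andP[].
Qed.

(** Sets with at most M vertices are handled by G alone.  For the others all pairs across
the cut are used: an edge of G contributes the factor 1 - q, and a non-edge contributes 1
- q m/N on average, which is the larger of the two. *)
Lemma sum_cutsum_additions m M q : (m <= #|N|)%N -> 0 <= q <= 1 ->
  \sum_(A in edge_additions G m) cutsum (G :|: A) n./2 q <=
  #|edge_additions G m|%:R * (cutsum G M q +
     2 ^+ n * (1 - q * (m%:R / #|N|%:R)) ^+ (M * (n - n./2))).
Proof.
move=> mN q01; have /andP[q0 q1] := q01.
have q0' : 0 <= 1 - q by rewrite subr_ge0.
have q1' : 1 - q <= 1 by rewrite gerBl.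
have mN1 : (m%:R / #|N|%:R : R) <= 1.
  have [->|N0] := posnP #|N|; first by rewrite invr0 mulr0.
  by rewrite ler_pdivrMr ?ltr0n // mul1r ler_nat.
have mN0 : 0 <= (m%:R / #|N|%:R : R) by rewrite divr_ge0.
set y := 1 - q * _.
have y0 : 0 <= y by rewrite subr_ge0 mulr_ile1.
have y1 : y <= 1 by rewrite gerBl mulr_ge0.
(* So a factor 1 - q coming from an edge of G may be weakened to y. *)
have qy : 1 - q <= y by rewrite lerD2l lerN2 ler_piMr.
rewrite /cutsum exchange_big /=.
set C := #|edge_additions G m|%:R : R.
have C0 : 0 <= C by [].
have bnd (S : {set 'I_n}) : (0 < #|S| <= n./2)%N ->
    \sum_(A in edge_additions G m) (1 - q) ^+ #|boundary (G :|: A) S| <=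
    C * ((if (#|S| <= M)%N then (1 - q) ^+ #|boundary G S| else 0) + y ^+ (M * (n - n./2))).
  move=> /andP[S0 Sn]; case: leqP => [SM|MS].
    apply: le_trans (_ : \sum_(A in edge_additions G m) (1 - q) ^+ #|boundary G S| <= _).
      apply: ler_sum => A; rewrite mem_edge_additions => /andP[AN _].
      by rewrite card_boundary_union // ler_wiXn2l // leq_addr.
    by rewrite sumr_const -[_ *+ _]mulr_natl ler_wpM2l // lerDl exprn_ge0.
  rewrite add0r (eq_bigl (fun A => (A \subset N) && (#|A| == m))); last first.
    by move=> A; rewrite mem_edge_additions.
  rewrite (eq_bigr (fun A => (1 - q) ^+ #|boundary G S| * (1 - q) ^+ #|A :&: boundary N S|)); last first.
    by move=> A /andP[AN _]; rewrite card_boundary_union // exprD.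
  rewrite -mulr_sumr.
  have bN : boundary N S \subset N by apply/subsetP => e; rewrite inE => /andP[].
  apply: le_trans (ler_wpM2l _ (avg_thinning mN bN q01)) _; first by rewrite exprn_ge0.
  rewrite mulrCA -card_edge_additions ler_wpM2l //.
  apply: le_trans (_ : y ^+ #|boundary G S| * y ^+ #|boundary N S| <= _).
    by rewrite ler_wpM2r ?exprn_ge0 // lerXn2r ?nnegrE.
  rewrite -exprD -card_boundary_split ler_wiXn2l //.
  apply: leq_trans (card_boundary_complete S).
  by apply: leq_mul; [exact: ltnW|exact: leq_sub2l].
apply: le_trans (ler_sum _ bnd) _.
rewrite -mulr_sumr ler_wpM2l // big_split /=; apply: lerD.
  rewrite big_mkcond [leRHS]big_mkcond /=; apply: ler_sum => S _.
  case: (boolP (#|S| <= M)%N) => SM; rewrite ?andbT ?andbF; last by case: ifP.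
  by case: (posnP #|S|) => //= _; case: ifP => // _; rewrite exprn_ge0.
rewrite sumr_const -[_ *+ _]mulr_natl ler_wpM2r ?exprn_ge0 //.
rewrite -natrX ler_nat; apply: leq_trans (max_card _) _.
by rewrite -cardsT -powersetT card_powerset cardsT card_ord.
Qed.

Lemma prob_added_le1 m (Q : {set {set 'I_n}} -> Prop) : prob_added R G m Q <= 1.
Proof.
rewrite /prob_added; have [->|c0] := posnP #|edge_additions G m|.
  by rewrite invr0 mulr0.
rewrite ler_pdivrMr ?ltr0n // mul1r ler_nat; apply: subset_leq_card.
by apply/subsetP => A; rewrite inE => /andP[].
Qed.

(** Markov's inequality for the cut sum of the augmented graph. *)
Lemma prob_added_ge m M q (t : R) (Q : {set {set 'I_n}} -> Prop) :
  (m <= #|N|)%N -> 0 <= q <= 1 -> 0 < t ->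
  (forall A, A \subset N -> #|A| = m -> cutsum (G :|: A) n./2 q <= t -> Q (G :|: A)) ->
  1 - t^-1 * (cutsum G M q + 2 ^+ n * (1 - q * (m%:R / #|N|%:R)) ^+ (M * (n - n./2)))
    <= prob_added R G m Q.
Proof.
move=> mN q01 t0 good; have /andP[q0 q1] := q01.
have := sum_cutsum_additions M mN q01.
set C := edge_additions G m => sumle.
have C0 : (0 : R) < #|C|%:R by rewrite ltr0n card_edge_additions bin_gt0.
rewrite /prob_added -/C ler_pdivlMr // mulrBl mul1r lerBlDr -lerBlDl.
rewrite mulrAC -mulrA ler_pdivlMl //.
apply: le_trans (_ : _ <= \sum_(A in C) cutsum (G :|: A) n./2 q) _; last exact: sumle.
rewrite [X in _ * (X - _)](_ : _ = \sum_(A in C) 1); last by rewrite sumr_const.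
rewrite [X in _ * (_ - X)](_ : _ = \sum_(A in C) (`[< Q (G :|: A) >]%:R : R)); last first.
  rewrite -sum1_card natr_sum big_mkcond [RHS]big_mkcond /=; apply: eq_bigr => A _.
  by rewrite inE; case: (A \in C) => //=; case: `[< _ >].
rewrite -sumrB mulr_sumr; apply: ler_sum => A.
rewrite mem_edge_additions => /andP[AN /eqP Am].
case: (boolP `[< Q (G :|: A) >]) => [_|/asboolP nQ].
  by rewrite subrr mulr0 cutsum_ge0.
rewrite subr0 mulr1 leNgt; apply/negP => lt; apply: nQ.
by apply: good => //; exact: ltW.
Qed.

End RandomCut.

(** * The zeta series and the sixth root of n *)

Section ZetaThree.
Local Open Scope classical_set_scope.
Local Open Scope ring_scope.
Variable R : realType.

Lemma zeta_partE L : zeta_part R L = series (fun j : nat => (j.+1%:R ^- 3 : R)) L.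
Proof. by rewrite /zeta_part /series /= big_mkord. Qed.

Lemma zeta_part_mono L L' : (L <= L')%N -> zeta_part R L <= zeta_part R L'.
Proof.
move=> LL'; rewrite /zeta_part -!(big_mkord xpredT (fun k => (k.+1%:R : R) ^- 3)).
rewrite (big_cat_nat _ LL') //= lerDl; apply: sumr_ge0 => k _.
by rewrite invr_ge0 exprn_ge0.
Qed.

(** The telescoping bound 1/k^3 <= 1/(k-1) - 1/k. *)
Lemma zeta_part_bound L : zeta_part R L.+1 <= 2 - L.+1%:R^-1.
Proof.
elim: L => [|L ih].
  by rewrite /zeta_part big_ord_recl big_ord0 /= addr0 expr1n invr1; lra.
rewrite /zeta_part big_ord_recr /=; apply: le_trans (lerD ih (lexx _)) _.
rewrite -[L.+2%:R]natr1; move: (L.+1%:R : R) (ltr0Sn R L) => y y0.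
rewrite -subr_ge0.
have -> : 2 - (y + 1)^-1 - (2 - y^-1 + (y + 1) ^- 3) = (y ^+ 2 + y + 1) / (y * (y + 1) ^+ 3).
  have y1 : 0 < y + 1 by lra.
  by field; rewrite !lt0r_neq0.
have y1 : 0 <= y + 1 by lra.
have y2 : 0 <= y by lra.
by rewrite divr_ge0 ?mulr_ge0 ?exprn_ge0 ?addr_ge0 ?exprn_ge0.
Qed.

Lemma zeta_part_cvg : zeta_part R L @[L --> \oo] --> zeta R 3.
Proof.
have -> : zeta_part R = series (fun j : nat => (j.+1%:R ^- 3 : R)).
  by apply/funext => L; exact: zeta_partE.
apply: nondecreasing_is_cvgn.
  by move=> L L' LL'; rewrite -!zeta_partE; exact: zeta_part_mono.
exists 2 => _ [L _ <-]; rewrite -zeta_partE.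
apply: le_trans (zeta_part_mono (leqnSn L)) _.
by apply: le_trans (zeta_part_bound L) _; rewrite gerBl invr_ge0.
Qed.

Lemma zeta3_gt0 : 0 < zeta R 3.
Proof.
apply: lt_le_trans (_ : zeta_part R 1 <= _).
  by rewrite /zeta_part big_ord_recl big_ord0 addr0 /= expr1n invr1 ltr01.
have h := zeta_part_cvg; rewrite -(cvg_lim (@Rhausdorff R) h).
apply: nondecreasing_cvgn_le; last by apply/cvg_ex; exists (zeta R 3).
by move=> L L' LL'; exact: zeta_part_mono.
Qed.

End ZetaThree.

Section SixthRoot.
Local Open Scope classical_set_scope.
Local Open Scope ring_scope.
Variable R : realType.

(** All scales of the proof are powers of this one: with u = n^(1/6), the cutoff L is
about u^2, the threshold x is u^(-5), and n^(5/3) = u^10. *)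
Definition sixth (n : nat) : R := n%:R `^ 6%:R^-1.

Lemma sixth_ge0 n : 0 <= sixth n. Proof. exact: powR_ge0. Qed.

Lemma sixth_gt0 n : (0 < n)%N -> 0 < sixth n.
Proof. by move=> n0; apply: powR_gt0; rewrite ltr0n. Qed.

Lemma sixth_pow n : sixth n ^+ 6 = n%:R.
Proof.
by rewrite -powR_mulrn ?sixth_ge0 // /sixth -powRrM mulVf ?powRr1 // pnatr_eq0.
Qed.

Lemma sixth_pow10 n : sixth n ^+ 10 = n%:R `^ (5 / 3).
Proof.
rewrite -powR_mulrn ?sixth_ge0 // /sixth -powRrM; congr powR.
by field.
Qed.

Lemma sixth_cvg : sixth n @[n --> \oo] --> +oo.
Proof.
apply/cvgryPge => A; near=> n.
have h : `|A| ^+ 6 <= n%:R by near: n; exact: nbhs_infty_ger.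
apply: le_trans (ler_norm A) _.
by rewrite -(@ler_pXn2r _ 6) ?nnegrE ?sixth_ge0 // sixth_pow.
Unshelve. all: by end_near. Qed.

Definition root_inv (n : nat) : R := (sixth n)^-1.

Lemma root_inv_cvg : root_inv n @[n --> \oo] --> (0 : R).
Proof.
apply/gtr0_cvgV0; last exact: sixth_cvg.
by near=> n; apply: sixth_gt0; near: n; exact: nbhs_infty_gt.
Unshelve. all: by end_near. Qed.

Definition size_cutoff (n : nat) : nat := Num.truncn (sixth n ^+ 2).

Lemma size_cutoff_itv n : (size_cutoff n)%:R <= sixth n ^+ 2 < (size_cutoff n).+1%:R.
Proof. by apply: truncn_itv; rewrite exprn_ge0 ?sixth_ge0. Qed.

Lemma size_cutoff_cvg : size_cutoff n @[n --> \oo] --> \oo.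
Proof.
apply/cvgnyPge => A; near=> n.
have h : (A%:R + 1 : R) <= sixth n.
  by near: n; move: (A%:R + 1 : R); apply/cvgryPge; exact: sixth_cvg.
have /andP[_ lt] := size_cutoff_itv n.
rewrite -ltnS -(ltr_nat R); apply: le_lt_trans lt.
apply: le_trans (_ : A%:R + 1 <= _); first by rewrite lerDl.
apply: (le_trans h); rewrite expr2 ler_peMl ?sixth_ge0 //.
by apply: le_trans h; rewrite lerDr.
Unshelve. all: by end_near. Qed.

End SixthRoot.

(** * Limits of the two bounds *)

Section Estimates.
Local Open Scope classical_set_scope.
Local Open Scope ring_scope.
Variables (R : realType) (alpha : R).
Hypothesis alpha0 : 0 < alpha.
Local Notation u := (sixth R).
Local Notation w := (root_inv R).
Local Notation L := (size_cutoff R).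

Definition threshold (n : nat) : R := w n ^+ 5.

(** The bound of [mst_lower] for r = alpha n at the threshold x, apart from the term |A|
x^2. *)
Definition lower_est (n : nat) : R :=
  n%:R / (alpha * n%:R + 1) * (1 - (alpha * n%:R * threshold n)^-1) *
  (zeta_part R (L n) - 2 * (L n)%:R / (alpha * n%:R)) - threshold n.

(** The terms of [mst_upper] that depend neither on delta nor on the cut sums. *)
Definition upper_est (n : nat) : R :=
  n%:R / (alpha * n%:R) * (zeta_part R (L n) + 4 * (L n)%:R / (alpha * n%:R)) +
  n%:R / (L n)%:R * threshold n.

Let ell (n : nat) : R := (L n)%:R * w n ^+ 2.

Lemma root_inv_pow_cvg k : (0 < k)%N -> w n ^+ k @[n --> \oo] --> (0 : R).
Proof.
move=> k0; have : w n ^+ k @[n --> \oo] --> (0 : R) ^+ k.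
  apply: (@cvg_comp _ _ _ w (fun x => x ^+ k)); first exact: root_inv_cvg.
  exact: exprn_continuous.
by rewrite expr0n eqn0Ngt k0.
Qed.

Lemma root_inv_gt0 n : (0 < n)%N -> 0 < w n.
Proof. by move=> n0; rewrite invr_gt0 sixth_gt0. Qed.

Lemma sixth_root_inv n : (0 < n)%N -> u n = (w n)^-1.
Proof. by rewrite /root_inv invrK. Qed.

Lemma natr_root_inv n : (0 < n)%N -> n%:R = (w n) ^- 6.
Proof. by move=> n0; rewrite -sixth_pow sixth_root_inv // exprVn. Qed.

Let ell_cvg : ell n @[n --> \oo] --> (1 : R).
Proof.
apply: (@squeeze_cvgr _ _ _ _ (fun n => 1 - w n ^+ 2) (fun=> 1)).
- near=> n; have n0 : (0 < n)%N by near: n; exact: nbhs_infty_gt.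
  have w0 := root_inv_gt0 n0; have /andP[le lt] := size_cutoff_itv R n.
  have uw : u n ^+ 2 * w n ^+ 2 = 1 by rewrite sixth_root_inv // -exprMn mulVf ?expr1n // gt_eqF.
  have w20 : 0 <= w n ^+ 2 by rewrite exprn_ge0 // ltW.
  rewrite -natr1 in lt; rewrite /ell; apply/andP; split; nra.
- rewrite -[X in _ --> X]subr0; apply: cvgB; first exact: cvg_cst.
  exact: root_inv_pow_cvg.
- exact: cvg_cst.
Unshelve. all: by end_near. Qed.

Let zeta_cvg : zeta_part R (L n) @[n --> \oo] --> zeta R 3.
Proof.
apply: (@cvg_comp _ _ _ L (zeta_part R)); first exact: size_cutoff_cvg.
exact: zeta_part_cvg.
Qed.

Let ell_w_cvg (c : R) : c * (ell n * w n ^+ 4 / alpha) @[n --> \oo] --> (0 : R).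
Proof.
have -> : (0 : R) = c * (1 * 0 / alpha) by ring.
apply: cvgM; first exact: cvg_cst.
by apply: cvgM; [apply: cvgM; [exact: ell_cvg|exact: root_inv_pow_cvg]|exact: cvg_cst].
Qed.

Lemma lower_est_cvg : lower_est n @[n --> \oo] --> zeta R 3 / alpha.
Proof.
have : (alpha + w n ^+ 6)^-1 * (1 - alpha^-1 * w n ^+ 1) *
    (zeta_part R (L n) - 2 * (ell n * w n ^+ 4 / alpha)) - w n ^+ 5
    @[n --> \oo] --> (alpha + 0)^-1 * (1 - alpha^-1 * 0) * (zeta R 3 - 0) - 0.
  apply: cvgB; last exact: root_inv_pow_cvg.
  apply: cvgM; last by apply: cvgB; [exact: zeta_cvg|exact: ell_w_cvg].
  apply: cvgM.
    apply: cvgV; first by rewrite addr0 gt_eqF.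
    by apply: cvgD; [exact: cvg_cst|exact: root_inv_pow_cvg].
  apply: cvgB; first exact: cvg_cst.
  by apply: cvgM; [exact: cvg_cst|exact: root_inv_pow_cvg].
rewrite (_ : _ - 0 = zeta R 3 / alpha); last by field; rewrite gt_eqF.
apply: cvg_trans; apply: near_eq_cvg; near=> n.
have n0 : (0 < n)%N by near: n; exact: nbhs_infty_gt.
have w0 := root_inv_gt0 n0; rewrite /lower_est /threshold /ell (natr_root_inv n0).
have aw : 0 < alpha + w n ^+ 6 by rewrite addr_gt0 // exprn_gt0.
have aw' : 0 < 1 + alpha / w n ^+ 6 by rewrite addr_gt0 // divr_gt0 // exprn_gt0.
move: (w n) (zeta_part _ _) ((L n)%:R : R) w0 aw aw' => y z l y0 aw aw'.
field.
rewrite !gt_eqF //.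
Unshelve. all: by end_near. Qed.

Lemma upper_est_cvg : upper_est n @[n --> \oo] --> zeta R 3 / alpha.
Proof.
have : alpha^-1 * (zeta_part R (L n) + 4 * (ell n * w n ^+ 4 / alpha)) + (ell n)^-1 * w n ^+ 1
    @[n --> \oo] --> alpha^-1 * (zeta R 3 + 0) + 1^-1 * 0.
  apply: cvgD.
    apply: cvgM; first exact: cvg_cst.
    by apply: cvgD; [exact: zeta_cvg|exact: ell_w_cvg].
  apply: cvgM; last exact: root_inv_pow_cvg.
  by apply: cvgV; [rewrite oner_neq0|exact: ell_cvg].
have /cvgnyPge/(_ 1%N) Lge1 := size_cutoff_cvg R.
rewrite (_ : _ + 1^-1 * 0 = zeta R 3 / alpha); last by field; rewrite gt_eqF.
apply: cvg_trans; apply: near_eq_cvg; near=> n.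
have n0 : (0 < n)%N by near: n; exact: nbhs_infty_gt.
have L0 : (0 < L n)%N by near: n; exact: Lge1.
have l0 : (0 : R) < (L n)%:R by rewrite ltr0n.
have w0 := root_inv_gt0 n0; rewrite /upper_est /threshold /ell (natr_root_inv n0).
move: (w n) (zeta_part _ _) ((L n)%:R : R) w0 l0 => y z l y0 l0.
field.
rewrite !gt_eqF //.
Unshelve. all: by end_near. Qed.

(** Since n = u^6, it is enough that exp(a u) dominates u^7. *)
Lemma natr_expR_sixth_cvg (a : R) : 0 < a -> n%:R * expR (- a * u n) @[n --> \oo] --> (0 : R).
Proof.
move=> a0; apply: (@squeeze_cvgr _ _ _ _ (fun=> 0) (fun n => (7 / a) ^+ 7 * w n ^+ 1)).
- near=> n; have n0 : (0 < n)%N by near: n; exact: nbhs_infty_gt.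
  have u0 := sixth_gt0 R n0; rewrite mulr_ge0 ?expR_ge0 //=.
  rewrite mulNr expRN -sixth_pow ler_pdivrMr ?expR_gt0 //.
  have e7 : (a * u n / 7) ^+ 7 <= expR (a * u n).
    rewrite [X in _ <= expR X](_ : _ = 7%:R * (a * u n / 7)); last by field.
    rewrite expRM_natl lerXn2r ?nnegrE ?expR_ge0 //.
      by rewrite divr_ge0 // mulr_ge0 // ltW.
    by apply: le_trans (expR_ge1Dx _); rewrite lerDr.
  have c0 : 0 <= (7 / a) ^+ 7 * w n ^+ 1.
    by rewrite mulr_ge0 ?exprn_ge0 ?divr_ge0 ?(ltW a0) // invr_ge0 ltW.
  apply: le_trans (ler_wpM2l c0 e7); rewrite /root_inv le_eqVlt; apply/orP; left.
  by apply/eqP; field; rewrite !gt_eqF.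
- exact: cvg_cst.
- rewrite -[X in _ --> X](mulr0 ((7 / a) ^+ 7)); apply: cvgM; first exact: cvg_cst.
  exact: root_inv_pow_cvg.
Unshelve. all: by end_near. Qed.

(** The product is squeezed between 0 and exp(n exp(-a u)) - 1.  This is the form in which
the union bounds over vertex sets tend to 0. *)
Lemma prod_expR_sixth_cvg (a : R) : 0 < a -> (1 + expR (- a * u n)) ^+ n - 1 @[n --> \oo] --> (0 : R).
Proof.
move=> a0; apply: (@squeeze_cvgr _ _ _ _ (fun=> 0) (fun n => expR (n%:R * expR (- a * u n)) - 1)).
- near=> n; apply/andP; split.
    by rewrite subr_ge0 exprn_ege1 // lerDl expR_ge0.
  rewrite lerD2r expRM_natl lerXn2r ?nnegrE ?addr_ge0 ?expR_ge0 //.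
  exact: expR_ge1Dx.
- exact: cvg_cst.
- rewrite -[X in _ --> X](subrr 1) -[X in X - _]expR0; apply: cvgB; last exact: cvg_cst.
  apply: (@cvg_comp _ _ _ _ expR); first exact: natr_expR_sixth_cvg.
  exact: continuous_expR.
Unshelve. all: by end_near. Qed.

End Estimates.

(** * Closeness of mst to its limit *)

Section EdgeCount.
Import mathcomp.boot.fintype mathcomp.boot.finset.
Local Open Scope set_scope.
Variable n : nat.

Lemma subset_nonedges (C G A : {set {set 'I_n}}) : A \subset C :\: G ->
  A \subset C /\ [disjoint G & A].
Proof. by rewrite subsetD => /andP[-> h]; split => //; rewrite disjoint_sym. Qed.

(** Counting incident pairs of a vertex and an edge in two ways. *)
Lemma handshake (E : {set {set 'I_n}}) : E \subset complete_graph n ->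
  (\sum_v degree E v = 2 * #|E|)%N.
Proof.
move=> sub.
have degE v : degree E v = (\sum_(e in E) (v \in e))%N.
  rewrite /degree -sum1_card [LHS]big_mkcond [RHS]big_mkcond /=; apply: eq_bigr => e _.
  by rewrite inE; case: (e \in E) => //=; case: (v \in e).
rewrite (eq_bigr _ (fun v _ => degE v)) exchange_big /= mulnC -sum_nat_const.
apply: eq_bigr => e eE; have := subsetP sub _ eE; rewrite inE => /eqP <-.
by rewrite -sum1_card [RHS]big_mkcond /=; apply: eq_bigr => v _; case: (v \in e).
Qed.

Lemma card_nonedges (G : {set {set 'I_n}}) r : G \subset complete_graph n ->
  (forall v, degree G v = r) ->
  (2 * #|complete_graph n :\: G| + n * r = n * n.-1)%N.
Proof.
move=> sub reg; rewrite cardsD (setIidPr sub).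
have -> : #|complete_graph n| = 'C(n, 2) by rewrite card_draws card_ord.
have hs := handshake sub; rewrite (eq_bigr _ (fun v _ => reg v)) sum_nat_const card_ord in hs.
have le : (#|G| <= 'C(n, 2))%N.
  by apply: leq_trans (subset_leq_card sub) _; rewrite card_draws card_ord.
by rewrite hs -mulnDr subnK // mulnC -[X in (_ * X)%N]/(2`!) bin_ffact ffactnS ffactn1.
Qed.
End EdgeCount.

Section Assembly.
Variables (R : realType) (alpha : R).
Hypothesis alpha0 : 0 < alpha.
Hypothesis alpha1 : alpha < 1.
Local Notation u := (sixth R).
Local Notation L := (size_cutoff R).
Local Notation x := (threshold R).

Lemma expR_pow_bound (y : R) k : y <= 1 -> (1 - y) ^+ k <= expR (- y * k%:R).
Proof.
move=> y1; rewrite mulrC expRM_natl lerXn2r ?nnegrE ?expR_ge0 ?subr_ge0 //.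
exact: expR_ge1Dx.
Qed.

(** The form of [cutsum_regular] to which [prod_expR_sixth_cvg] applies. *)
Lemma cutsum_expR n r M (G : {set {set 'I_n}}) (q a : R) :
  (forall v, #|nbrs G v [set: 'I_n]%SET| = r) -> 0 <= q <= 1 ->
  a * u n <= q * (r - M)%:R ->
  cutsum G M q <= (1 + expR (- a * u n)) ^+ n - 1.
Proof.
move=> reg q01 h; have /andP[q0 q1] := q01.
apply: le_trans (cutsum_regular M reg q01) _.
rewrite lerD2r lerXn2r ?nnegrE ?addr_ge0 ?exprn_ge0 ?subr_ge0 ?expR_ge0 //.
rewrite lerD2l; apply: le_trans (expR_pow_bound _ q1) _.
by rewrite ler_expR !mulNr lerN2.
Qed.

Lemma sixth_le n : (0 < n)%N -> u n <= n%:R.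
Proof.
move=> n0; have u1 : 1 <= u n.
  rewrite -(@ler_pXn2r _ 6) ?nnegrE ?sixth_ge0 // expr1n sixth_pow.
  by rewrite ler1n.
by rewrite -(sixth_pow R n) exprS ler_peMr ?sixth_ge0 // exprn_ege1.
Qed.

Local Open Scope classical_set_scope.

Lemma half_third r : (1 < r)%N -> (r <= 3 * r./2)%N.
Proof.
move=> r1; have := odd_double_half r; rewrite -muln2.
have : (0 < r./2)%N by rewrite half_gt0.
have := leq_b1 (odd r).
move: (r./2) (nat_of_bool (odd r)) => h b; clear; lia.
Qed.

Lemma half_le r : (2 * r./2 <= r)%N.
Proof. by rewrite mul2n -[X in (_ <= X)%N](odd_double_half r) leq_addl. Qed.

Lemma eventually_estimates (e delta : R) : 0 < e -> 0 < delta ->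
  \forall n \near \oo, [/\ (0 < n)%N, 1 <= alpha * u n, x n <= delta /\ x n <= 1,
    (0 < L n)%N /\ 4 * (L n)%:R ^+ 2 <= alpha * n%:R &
    [/\ 2 <= alpha * n%:R, zeta R 3 / alpha - e <= lower_est alpha n,
       upper_est alpha n <= zeta R 3 / alpha + e &
       (1 + expR (- (alpha / 2) * u n)) ^+ n - 1 <= 1]].
Proof.
move=> e0 delta0.
have /cvgryPge ucvg := @sixth_cvg R.
have xcvg := @root_inv_pow_cvg R 5 isT.
have /cvgnyPge/(_ 1%N) Lge1 := @size_cutoff_cvg R.
have a2 : 0 < alpha / 2 by rewrite divr_gt0.
near=> n.
have n0 : (0 < n)%N by near: n; exact: nbhs_infty_gt.
have u0 := sixth_gt0 R n0.
have u1 : 1 <= u n by near: n; exact: ucvg.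
have u4 : 4 / alpha <= u n by near: n; exact: ucvg.
have au : 4 <= alpha * u n by rewrite mulrC -ler_pdivrMr.
have un := sixth_le n0.
split => //.
- by apply: le_trans au; lra.
- split; near: n.
    by move/cvgrPdist_le : xcvg => /(_ _ delta0); apply: filterS => n; rewrite sub0r normrN => /ler_normlW.
  by move/cvgrPdist_le : xcvg => /(_ _ (ltr01)); apply: filterS => n; rewrite sub0r normrN => /ler_normlW.
- split; first by near: n; exact: Lge1.
  have /andP[le _] := size_cutoff_itv R n.
  have LL : (L n)%:R ^+ 2 <= (u n ^+ 2) ^+ 2 by rewrite lerXn2r ?nnegrE ?exprn_ge0 // ltW.
  apply: le_trans (_ : 4 * (u n ^+ 2) ^+ 2 <= _); first by rewrite ler_wpM2l.
  rewrite -(sixth_pow R n) (_ : alpha * u n ^+ 6 = (alpha * u n) * u n * (u n ^+ 2) ^+ 2); last by ring.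
  rewrite ler_wpM2r ?exprn_ge0 ?(ltW u0) //.
  by rewrite -[X in X <= _]mulr1 ler_pM.
- split.
  + by apply: le_trans (_ : alpha * u n <= _); [lra|rewrite ler_wpM2l // ltW].
  + near: n; have /cvgrPdist_le/(_ _ e0) := lower_est_cvg alpha0.
    by apply: filterS => n; rewrite ler_distlC => /andP[].
  + near: n; have /cvgrPdist_le/(_ _ e0) := upper_est_cvg alpha0.
    by apply: filterS => n; rewrite ler_distlC => /andP[].
  + near: n; have /cvgrPdist_le/(_ _ ltr01) := prod_expR_sixth_cvg a2.
    by apply: filterS => n; rewrite sub0r normrN => /ler_normlW.
Unshelve. all: by end_near. Qed.

(** The choice of delta makes the contribution of the range from x to delta at most e/4;
it depends on alpha and e only, so that the remaining hypotheses on A are the ones that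
random edges satisfy with high probability. *)
Lemma mst_window (e : R) : 0 < e -> exists2 delta : R, 0 < delta <= 1 &
  \forall n \near \oo, forall (r : nat) (G A : {set {set 'I_n}}) (d : measure_display)
    (Omega : measurableType d) (P : probability Omega R) (W : {set 'I_n} -> {RV P >-> R}),
    iid_uniform_weights W -> (r%:R : R) = alpha * n%:R ->
    (forall v, #|nbrs G v [set: 'I_n]%SET| = r) ->
    G \subset complete_graph n -> A \subset (complete_graph n :\: G)%SET ->
    connected_graph (G :|: A)%SET ->
    #|A|%:R * x n ^+ 2 <= e / 2 -> cutsum (G :|: A)%SET n./2 delta <= e / 2 ->
    `|mst W (G :|: A)%SET - zeta R 3 / alpha| <= e.
Proof.
move=> e0; set B := 1 + 3 / alpha.
have B1 : 1 <= B by rewrite lerDl divr_ge0 // ltW.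
have B0 : 0 < B by exact: lt_le_trans B1.
(* B bounds the sum of n/(r/2), with r/2 rounded down, and of the cut sum of G at x, so that B * delta <= e / 4. *)
pose delta := Num.min 1 (e / 4 / B).
have delta0 : 0 < delta by rewrite lt_min ltr01 !divr_gt0.
have delta1 : delta <= 1 by rewrite ge_min lexx.
have deltaB : B * delta <= e / 4.
  by rewrite mulrC -ler_pdivlMr // ge_min lexx orbT.
exists delta; first by rewrite delta0.
have e4 : 0 < e / 4 by rewrite divr_gt0.
apply: filterS (eventually_estimates e4 delta0) => n [n0 au [xd x1] [L0 LL] [an le ue pr]].
move=> r G A d Omega P W iidW rE reg subG subAN cH Ax cut.
have [subA dGA] := subset_nonedges subAN.
have r2 : (1 < r)%N by rewrite -(ltr_nat R) rE; apply: lt_le_trans an; rewrite ltr_nat.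
have r0 : (0 < r)%N by exact: ltnW.
have L4 : (4 * L n ^ 2 <= r)%N by rewrite -(ler_nat R) natrM natrX rE.
have u0 := sixth_gt0 R n0.
have x0 : 0 < x n by rewrite exprn_gt0 // invr_gt0.
have rx : r%:R * x n = alpha * u n.
  by rewrite rE -(sixth_pow R n) /threshold /root_inv; field; rewrite gt_eqF.
have M0 : (0 < r./2)%N by rewrite half_gt0.
have /andP[lo hi] : lower_est alpha n - #|A|%:R * x n ^+ 2 <= mst W (G :|: A)%SET <=
    upper_est alpha n + B * delta + cutsum (G :|: A)%SET n./2 delta.
  apply/andP; split.
    have rx1 : 1 <= r%:R * x n by rewrite rx.
    have := mst_lower n0 iidW reg dGA subG subA cH r0 L0 L4 x0 x1 rx1.
    rewrite -natr1 rE /lower_est; apply: le_trans; rewrite le_eqVlt; apply/orP; left.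
    by apply/eqP; ring.
  have := mst_upper n0 iidW reg dGA subG subA cH r0 L0 L4 M0 (ltW x0) xd delta1.
  rewrite rE => h; apply: le_trans h _; rewrite lerD2r lerD2l.
  rewrite ler_wpM2r ?(ltW delta0) //; apply: lerD.
    apply: le_trans pr; apply: (@cutsum_expR _ r) => //; first by rewrite ltW.
    have half : r%:R / 2 <= (r - r./2)%:R :> R.
      rewrite ler_pdivrMr // -natrM ler_nat; have := half_le r.
      by clear; move: (r./2) => h; lia.
    apply: le_trans (ler_wpM2l (ltW x0) half); rewrite mulrA [x n * _]mulrC rx; lra.
  rewrite ler_pdivrMr ?ltr0n // mulrAC ler_pdivlMr // mulrC -rE.
  by rewrite -natrM ler_nat half_third.
by rewrite ler_distlC; apply/andP; split; lra.
Qed.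

End Assembly.

(** * Cut sums of large regular graphs *)

Section Regular.
Local Open Scope classical_set_scope.
Local Open Scope ring_scope.
Variables (R : realType) (alpha : R).
Hypothesis alpha0 : 0 < alpha.
Hypothesis alpha1 : alpha < 1.

(** As r - n/2 = (alpha - 1/2) n, every set of at most n/2 vertices already sends enough
edges of G outside. *)
Lemma cutsum_dense (delta e : R) : 1 / 2 < alpha -> 0 < delta <= 1 -> 0 < e ->
  \forall n \near \oo, forall (r : nat) (G : {set {set 'I_n}}),
    (r%:R : R) = alpha * n%:R -> (forall v, #|nbrs G v [set: 'I_n]%SET| = r) ->
    cutsum G n./2 delta <= e.
Proof.
move=> ha /andP[d0 d1] e0; set a := delta * (alpha - 1 / 2).
have a0 : 0 < a by rewrite mulr_gt0 // subr_gt0.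
have /cvgrPdist_le/(_ _ e0) lim := prod_expR_sixth_cvg a0.
near=> n; have n0 : (0 < n)%N by near: n; exact: nbhs_infty_gt.
have le : (1 + expR (- a * sixth R n)) ^+ n - 1 <= e.
  by near: n; apply: filterS lim => n; rewrite sub0r normrN => /ler_normlW.
move=> r G rE reg; apply: le_trans le; apply: (@cutsum_expR _ _ r) => //.
  by rewrite ltW.
rewrite -mulrA ler_wpM2l ?(ltW d0) //.
have hn : (n./2%:R : R) <= n%:R / 2.
  by rewrite ler_pdivlMr // -natrM ler_nat mulnC half_le.
apply: le_trans (_ : (alpha - 1 / 2) * n%:R <= _).
  by rewrite ler_wpM2l ?sixth_le // subr_ge0 ltW.
have rn : (n./2 <= r)%N by rewrite -(ler_nat R) rE; apply: le_trans hn _; rewrite mulrC ler_wpM2r //; lra.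
by rewrite natrB // rE mulrBl; lra.
Unshelve. all: by end_near. Qed.

Lemma cutsum_small_sets (delta e : R) : 0 < delta <= 1 -> 0 < e ->
  \forall n \near \oo, forall (r : nat) (G : {set {set 'I_n}}),
    (r%:R : R) = alpha * n%:R -> (forall v, #|nbrs G v [set: 'I_n]%SET| = r) ->
    cutsum G r./2 delta <= e.
Proof.
move=> /andP[d0 d1] e0; set a := delta * (alpha / 2).
have a0 : 0 < a by rewrite mulr_gt0 // divr_gt0.
have /cvgrPdist_le/(_ _ e0) lim := prod_expR_sixth_cvg a0.
near=> n; have n0 : (0 < n)%N by near: n; exact: nbhs_infty_gt.
have le : (1 + expR (- a * sixth R n)) ^+ n - 1 <= e.
  by near: n; apply: filterS lim => n; rewrite sub0r normrN => /ler_normlW.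
move=> r G rE reg; apply: le_trans le; apply: (@cutsum_expR _ _ r) => //.
  by rewrite ltW.
rewrite -mulrA ler_wpM2l ?(ltW d0) //.
have hr : (r./2%:R : R) <= r%:R / 2.
  by rewrite ler_pdivlMr // -natrM ler_nat mulnC half_le.
apply: le_trans (_ : alpha / 2 * n%:R <= _).
  by rewrite ler_wpM2l ?sixth_le // divr_ge0 // ltW.
have rr : (r./2 <= r)%N by rewrite -{2}(odd_double_half r) -addnn addnA leq_addl.
by rewrite natrB // rE; move: hr; rewrite rE; lra.
Unshelve. all: by end_near. Qed.

Lemma many_nonedges : \forall n \near \oo, forall (r : nat) (G : {set {set 'I_n}}),
    (r%:R : R) = alpha * n%:R -> (forall v, degree G v = r) ->
    G \subset complete_graph n ->
    (1 - alpha) / 4 * n%:R ^+ 2 <= (#|(complete_graph n :\: G)%SET|%:R : R) <= n%:R ^+ 2 / 2.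
Proof.
near=> n; have n0 : (0 < n)%N by near: n; exact: nbhs_infty_gt.
have nl : 2 / (1 - alpha) <= n%:R by near: n; exact: nbhs_infty_ger.
have nl' : 2 <= (1 - alpha) * n%:R by rewrite mulrC -ler_pdivrMr // subr_gt0.
move=> r G rE deg sub; have := card_nonedges sub deg.
move=> /(congr1 (fun k => k%:R : R)); rewrite natrD !natrM rE -subn1 natrB //.
have np : (1 : R) <= n%:R by rewrite ler1n.
move: (#|_|%:R : R) (n%:R : R) np nl' => N y y1 nl' h.
have h1 : 0 <= alpha * (y * y) by rewrite !mulr_ge0 // ?(ltW alpha0) //; lra.
have h2 : 2 * y <= (1 - alpha) * y * y by rewrite ler_wpM2r //; lra.
by rewrite !expr2; apply/andP; split; lra.
Unshelve. all: by end_near. Qed.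

(** The exponent is at least alpha n^2/6 and N is at most n^2/2, so the product is at most
exp(n - delta alpha m/3); this is where m much larger than n is used. *)
Lemma big_cuts_vanish (delta e : R) (m : nat -> nat) (F : set_system nat) :
  ProperFilter F -> F `=>` \oo ->
  0 < delta <= 1 -> 0 < e ->
  much_greater F (fun n => (m n)%:R) (fun n => n%:R * ln n%:R : R) ->
  \forall n \near F, forall (r N : nat), (r%:R : R) = alpha * n%:R ->
    (N%:R : R) <= n%:R ^+ 2 / 2 -> (0 < N)%N -> (m n <= N)%N ->
    2 ^+ n * (1 - delta * ((m n)%:R / N%:R)) ^+ (r./2 * (n - n./2)) <= e.
Proof.
move=> FF Foo /andP[d0 d1] e0 /cvgryPge mbig.
have lim := @natr_expR_sixth_cvg R 1 ltr01.
have /cvgrPdist_le/(_ _ e0) lim' := lim.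
near=> n; have n0 : (0 < n)%N by near: n; apply: Foo; exact: nbhs_infty_gt.
have le : n%:R * expR (- 1 * sixth R n) <= e.
  by near: n; apply: Foo; apply: filterS lim' => n; rewrite sub0r normrN => /ler_normlW.
have ne : expR 1 <= n%:R :> R by near: n; apply: Foo; exact: nbhs_infty_ger.
have n2 : 2 / alpha <= n%:R by near: n; apply: Foo; exact: nbhs_infty_ger.
have mC : 6 * 2 / (delta * alpha) <= (m n)%:R / (n%:R * ln n%:R) by near: n; exact: mbig.
move=> r N rE Nn N0 mN.
have nR : (0 : R) < n%:R by rewrite ltr0n.
have ln1 : 1 <= ln n%:R :> R.
  by rewrite -[leLHS](expRK 1) ler_ln ?posrE ?expR_gt0.
have da : 0 < delta * alpha by rewrite mulr_gt0.
have mn : 6 * 2 / (delta * alpha) * n%:R <= (m n)%:R.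
  have nl0 : 0 < n%:R * ln n%:R :> R by rewrite mulr_gt0 //; lra.
  rewrite ler_pdivlMr // in mC; apply: le_trans mC.
  rewrite ler_wpM2l // ?divr_ge0 ?(ltW da) //.
  by rewrite ler_peMr // ltW.
have N0' : (0 : R) < N%:R by rewrite ltr0n.
have mN1 : (m n)%:R / N%:R <= 1 :> R by rewrite ler_pdivrMr // mul1r ler_nat.
have mN0 : 0 <= (m n)%:R / N%:R :> R by rewrite divr_ge0.
have e2 : (2 : R) ^+ n <= expR n%:R.
  rewrite -[n%:R]mulr1 expRM_natl lerXn2r ?nnegrE ?expR_ge0 //.
  by apply: le_trans (expR_ge1Dx 1).
set y := delta * _; set K := (_ * (n - _))%N.
have y1 : y <= 1 by rewrite mulr_ile1 // ltW.
have r2 : (1 < r)%N by rewrite -(ltr_nat R) rE mulrC -ltr_pdivrMr //; apply: lt_le_trans n2; rewrite ltr_pM2r ?invr_gt0 // ltr_nat.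
have KE : alpha * n%:R ^+ 2 / 6 <= K%:R.
  have h3 := half_third r2; have h4 := half_le n.
  have hM : alpha * n%:R / 3 <= (r./2)%:R by rewrite -rE ler_pdivrMr // -natrM ler_nat mulnC.
  have hn : n%:R / 2 <= (n - n./2)%:R :> R.
    rewrite ler_pdivrMr // -natrM ler_nat.
    by move: h4; clear; move: (n./2) => h; lia.
  rewrite natrM; apply: le_trans (ler_pM _ _ hM hn); rewrite ?divr_ge0 ?mulr_ge0 ?(ltW alpha0) //.
  by rewrite le_eqVlt; apply/orP; left; apply/eqP; field.
have yK : 2 * n%:R <= y * K%:R.
  have h1 : 12 * n%:R <= delta * alpha * (m n)%:R.
    rewrite [leRHS]mulrC -ler_pdivrMr //; apply: le_trans mn; rewrite le_eqVlt; apply/orP; left.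
    by apply/eqP; field; rewrite !gt_eqF.
  have -> : y * K%:R = delta * (m n)%:R * K%:R / N%:R by rewrite /y; ring.
  rewrite ler_pdivlMr //.
  apply: le_trans (_ : delta * (m n)%:R * (alpha * n%:R ^+ 2 / 6) <= _); last first.
    by rewrite ler_wpM2l // mulr_ge0 // ltW.
  apply: le_trans (_ : 12 * n%:R * (n%:R ^+ 2 / 6) <= _); last first.
    rewrite (_ : _ * (alpha * _ / 6) = delta * alpha * (m n)%:R * (n%:R ^+ 2 / 6)); last by ring.
    by rewrite ler_wpM2r // divr_ge0 ?exprn_ge0.
  rewrite (_ : 12 * _ * _ = 2 * n%:R * n%:R ^+ 2); last by field.
  rewrite ler_wpM2l ?mulr_ge0 //; apply: le_trans Nn _.
  by rewrite ler_pdivrMr // ler_peMr ?exprn_ge0 //; lra.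
apply: le_trans (_ : expR n%:R * expR (- y * K%:R) <= _).
  by rewrite ler_pM ?exprn_ge0 ?subr_ge0 // expR_pow_bound.
rewrite -expRD; apply: le_trans le.
apply: le_trans (_ : expR (- 1 * sixth R n) <= _).
  have := sixth_le R n0; rewrite ler_expR mulNr mul1r; lra.
by rewrite ler_peMl ?expR_ge0 // ler1n.
Unshelve. all: by end_near. Qed.

End Regular.

(** * Minimum spanning trees of randomly augmented regular graphs *)

Unset Implicit Arguments.
Set Strict Implicit.
Set Printing Implicit Defensive.

Local Open Scope classical_set_scope.
Local Open Scope ring_scope.

Theorem theorem1 (R : realType) (alpha : R) (halpha : 0 < alpha < 1)
  (S : set nat) (hS : infinite_set S)
  (G : forall n : nat, {set {set 'I_n}})
  (hG : forall n, S n -> G n \subset complete_graph n)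
  (hreg : forall n, S n ->
     forall v : 'I_n, (degree (G n) v)%:R = alpha * n%:R)
  (d : nat -> measure_display) (Omega : forall n : nat, measurableType (d n))
  (P : forall n : nat, probability (Omega n) R)
  (W : forall n : nat, {set 'I_n} -> {RV (P n) >-> R})
  (hW : forall n, iid_uniform_weights (W n)) :
  (forall m : nat -> nat,
     much_greater (within S \oo)
       (fun n => (m n)%:R) (fun n => n%:R * ln n%:R : R) ->
     much_greater (within S \oo)
       (fun n => n%:R `^ (5 / 3) : R) (fun n => (m n)%:R) ->
     forall eps : R, 0 < eps ->
       prob_added R (G n) (m n)
         (fun H => connected_graph H /\
            `|mst (W n) H / (zeta R 3 / alpha) - 1| <= eps)
         @[n --> within S \oo] --> (1 : R)) /\
  (1 / 2 < alpha ->
     (\forall n \near within S \oo, connected_graph (G n)) /\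
     (fun n => mst (W n) (G n)) ~_(within S \oo) (fun=> zeta R 3 / alpha)).
Proof.
have /andP[alpha0 alpha1] := halpha.
set F := within S \oo.
have Foo : F `=>` \oo by exact: cvg_within.
have FF : ProperFilter F.
  split; last by exact: within_filter.
  move=> [N _ hN]; apply: hS; apply: sub_finite_set (finite_II N) => n Sn /=.
  by rewrite ltnNge; apply/negP => Nn; exact: (hN n Nn Sn).
have inS : \forall n \near F, S n by exact: withinT.
pose r n := Num.truncn (alpha * n%:R).
have deg n : S n -> forall v : 'I_n, degree (G n) v = r n.
  by move=> Sn v; rewrite /r -(hreg n Sn v) natrK.
have reg n : S n -> forall v : 'I_n, #|nbrs (G n) v [set: 'I_n]%SET| = r n.
  by move=> Sn v; rewrite card_nbrs_degree ?deg //; exact: hG.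
have rE n : S n -> (0 < n)%N -> (r n)%:R = alpha * n%:R.
  by move=> Sn n0; rewrite -(deg n Sn (Ordinal n0)) hreg.
have npos : \forall n \near F, (0 < n)%N by apply: Foo; exact: nbhs_infty_gt.
have z0 : 0 < zeta R 3 / alpha by rewrite divr_gt0 // zeta3_gt0.
split.
- move=> m m1 m2 eps eps0; apply/cvgrPdist_le => t t0.
  pose e := eps * (zeta R 3 / alpha).
  have e0 : 0 < e by rewrite mulr_gt0.
  have [delta d01 win] := mst_window alpha0 e0.
  have /andP[d0 d1] := d01.
  (* A cut sum of at most 1/2 also forces connectivity. *)
  pose th := Num.min (e / 2) (1 / 2).
  have th0 : 0 < th by rewrite lt_min !divr_gt0.
  have tt0 : 0 < th * t / 2 by rewrite divr_gt0 // mulr_gt0.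
  have c1 := Foo _ (cutsum_small_sets alpha0 d01 tt0).
  have c2 := big_cuts_vanish alpha0 FF Foo d01 tt0 m1.
  have c3 := Foo _ (many_nonedges alpha0 alpha1).
  have th_e : th <= e / 2 by rewrite ge_min lexx.
  have th_1 : th <= 1 / 2 by rewrite ge_min lexx orbT.
  have /cvgryPge m2' := m2.
  have m2e := m2' (2 / e); have m2a := m2' (4 / (1 - alpha)).
  apply: filterS (filterI (filterI inS npos) (filterI (filterI (Foo _ win) c1)
    (filterI (filterI c2 c3) (filterI m2e m2a)))) => n.
  move=> [[Sn n0] [[winn c1n] [[c2n c3n] [m2en m2an]]]].
  have rEn := rE n Sn n0; have regn := reg n Sn; have subn := hG n Sn.
  have u0 := sixth_gt0 R n0.
  have nR : (0 : R) < n%:R by rewrite ltr0n.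
  have p53 : (n%:R : R) `^ (5 / 3) <= n%:R ^+ 2.
    rewrite -sixth_pow10 -[X in _ <= X ^+ 2](sixth_pow R n) -exprM.
    have u1 : 1 <= sixth R n.
      by rewrite -(@ler_pXn2r _ 6) ?nnegrE ?sixth_ge0 // expr1n sixth_pow ler1n.
    by rewrite ler_weXn2l.
  have /andP[Nlo Nhi] := c3n (r n) (G n) rEn (deg n Sn) subn.
  set N := #|(complete_graph n :\: G n)%SET| in Nlo Nhi.
  have N0 : (0 < N)%N.
    rewrite -(ltr_nat R); apply: lt_le_trans Nlo.
    by rewrite mulr_gt0 ?exprn_gt0 // divr_gt0 // subr_gt0.
  have mbound c : 0 < c -> c <= n%:R `^ (5 / 3) / (m n)%:R -> c * (m n)%:R <= n%:R `^ (5 / 3) :> R.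
    move=> c0; have [->|mn0] := posnP (m n); first by rewrite mulr0 powR_ge0.
    by rewrite ler_pdivlMr // ltr0n.
  (* There are of order n^2 non-edges, more than n^(5/3), so m of them can be added. *)
  have mN : (m n <= N)%N.
    rewrite -(ler_nat R); apply: le_trans Nlo.
    have a1 : 0 < 1 - alpha by rewrite subr_gt0.
    have := mbound _ (_ : 0 < 4 / (1 - alpha)) m2an; rewrite divr_gt0 // => /(_ isT) h.
    have := le_trans h p53; rewrite mulrC mulrA ler_pdivrMr // => h2; lra.
  have c1n' := c1n (r n) (G n) rEn regn.
  have c2n' := c2n (r n) N rEn Nhi N0 mN.
  rewrite ger0_norm; last by rewrite subr_ge0 prob_added_le1.
  rewrite lerBlDr -lerBlDl.
  apply: le_trans (prob_added_ge subn (r n)./2 mN (_ : 0 <= delta <= 1) th0 _); last 2 first.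
  - by rewrite ltW.
  - move=> A AN cA cut.
    have cH : connected_graph (G n :|: A)%SET.
      apply: contrapT => ncH.
      have subH : (G n :|: A)%SET \subset complete_graph n.
        by have [sA _] := subset_nonedges AN; rewrite finset.subUset subn.
      have := disconnected_cut n0 subH ncH (_ : 0 <= delta <= 1); rewrite (ltW d0) d1.
      by move=> /(_ isT); lra.
    split => //.
    have Ax : #|A|%:R * threshold R n ^+ 2 <= e / 2.
      have xE : threshold R n ^+ 2 = (n%:R `^ (5 / 3))^-1.
        by rewrite -sixth_pow10 /threshold /root_inv -exprM exprVn.
      have p0 : 0 < (n%:R : R) `^ (5 / 3) by rewrite powR_gt0.
      rewrite cA xE ler_pdivrMr //.
      have := mbound _ (_ : 0 < 2 / e) m2en; rewrite divr_gt0 // => /(_ isT).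
      by rewrite mulrAC ler_pdivrMr // => h; rewrite mulrAC ler_pdivlMr // mulrC; lra.
    have := winn (r n) (G n) A _ _ _ (W n) (hW n) rEn regn subn AN cH Ax (le_trans cut th_e).
    have zn : zeta R 3 / alpha != 0 by rewrite gt_eqF.
    rewrite -[X in _ -> `|_ - X| <= _](divff zn) -mulrBl normrM normfV (gtr0_norm z0) ler_pdivrMr //.
  rewrite lerD2l lerN2 ler_pdivrMl //.
  by apply: le_trans (lerD c1n' c2n') _; lra.
- move=> ahalf.
  have dense (delta e : R) : 0 < delta <= 1 -> 0 < e ->
      \forall n \near F, cutsum (G n) n./2 delta <= e.
    move=> d01 e0; have c := Foo _ (cutsum_dense ahalf d01 e0).
    apply: filterS (filterI (filterI inS npos) c) => n [[Sn n0] cn].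
    exact: (cn (r n) (G n) (rE n Sn n0) (reg n Sn)).
  have conn : \forall n \near F, connected_graph (G n).
    have d1 : (0 : R) < (1 : R) <= 1 by rewrite ltr01 lexx.
    have h0 : (0 : R) < 1 / 2 by [].
    apply: filterS (filterI (filterI inS npos) (dense _ _ d1 h0)) => n [[Sn n0] cn].
    apply: contrapT => ncH.
    have := disconnected_cut n0 (hG n Sn) ncH (_ : 0 <= (1 : R) <= 1).
    by rewrite ler01 lexx => /(_ isT); lra.
  split => //; apply/eqaddoP => eps eps0.
  pose e := eps * (zeta R 3 / alpha).
  have e0 : 0 < e by rewrite mulr_gt0.
  have e20 : 0 < e / 2 by rewrite divr_gt0.
  have [delta d01 win] := mst_window alpha0 e0.
  apply: filterS (filterI (filterI (filterI inS npos) conn)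
    (filterI (Foo _ win) (dense _ _ d01 e20))) => n [[[Sn n0] cn] [winn cut]].
  have := winn (r n) (G n) finset.set0 _ _ _ (W n) (hW n) (rE n Sn n0) (reg n Sn) (hG n Sn).
  rewrite finset.setU0 cards0 mul0r => h.
  rewrite /= (gtr0_norm z0); apply: h => //; first exact: finset.sub0set.
  exact: ltW.
Qed.
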